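(* For $\mathscr D$ a dioperad without unit, the structure map $\mu_{\mathscr D}$ induces (via the contractions specified in the context): (1) a natural $\Bbbk\mathsf{dwb}$-module structure on $S_\circledcirc^*\mathscr D$; (2) a natural $(\Bbbk\mathsf{dwb})_-$-module structure on $\Lambda_\circledcirc^*\mathscr D$. This yields functors from the category of dioperads without unit to $\Bbbk\mathsf{dwb}$-modules and to $(\Bbbk\mathsf{dwb})_-$-modules, respectively.
   Context: $\Bbbk$ is a field of characteristic zero; $\mathbf n=\{1,\dots,n\}$, $\mathbf 0=\emptyset$; $\mathsf{FB}$ is the category of finite sets and bijections; modules over a $\Bbbk$-linear category are $\Bbbk$-linear functors to $\Bbbk$-vector spaces. **Category.** For $\delta\in\{+,-\}$, $(\Bbbk\mathsf{uwb})_\delta$ has objects pairs of finite sets; morphisms $(X,Y)\to(U,V)$ are zero unless $|U|-|X|=|V|-|Y|=n\in\mathbb N$, and then are $\Bbbk(\mathsf{FB}\times\mathsf{FB})((X\amalg\mathbf n,Y\amalg\mathbf n),(U,V))\otimes_{\Bbbk\mathfrak S_n}\Bbbk^\delta$ (diagonal $\mathfrak S_n$; $\Bbbk^+$ trivial, $\Bbbk^-$ sign), i.e. pairs of injections with an ordered list of walled pairs in $U\times V$. Composition $g\circ f$: compose injections and concatenate lists (the $g$-images of the pairs of $f$, then the pairs of $g$). $(\Bbbk\mathsf{dwb})_\delta$ is the opposite category; $\Bbbk\mathsf{dwb}=(\Bbbk\mathsf{dwb})_+$. For $(s,t)\in X\times Y$, $\iota_{(s,t)}\colon(X\setminus\{s\},Y\setminus\{t\})\to(X,Y)$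 is given by the inclusions and the single walled pair $(s,t)$; bijections and the $\iota_{(s,t)}$ generate $(\Bbbk\mathsf{uwb})_\delta$, so a $(\Bbbk\mathsf{dwb})_\delta$-module is determined by its underlying $\Bbbk(\mathsf{FB}\times\mathsf{FB})$-module $M$ and the contractions $c_{(s,t)}\colon M(X,Y)\to M(X\setminus\{s\},Y\setminus\{t\})$ given by $\iota_{(s,t)}^{op}$. **Convolution.** $(F\circledcirc G)(X,Y)=\bigoplus_{X=X_1\amalg X_2,\,Y=Y_1\amalg Y_2}F(X_1,Y_1)\otimes G(X_2,Y_2)$; $S_\circledcirc^rG=G^{\circledcirc r}/\mathfrak S_r$, $\Lambda_\circledcirc^rG=(G^{\circledcirc r}\otimes\mathrm{sgn}_r)/\mathfrak S_r$, $S_\circledcirc^*=\bigoplus_rS^r_\circledcirc$, $\Lambda_\circledcirc^*=\bigoplus_r\Lambda_\circledcirc^r$; $a_1\cdots a_r$ and $a_1\wedge\dots\wedge a_r$ denote classes of $a_1\otimes\dots\otimes a_r$. **Dioperad without unit.** A $\Bbbk(\mathsf{FB}\times\mathsf{FB})$-module $\mathscr D$ with $\mathscr D(\mathbf 0,\mathbf 0)=0$ and a structure map $\mu_{\mathscr D}$, that is, maps natural for bijections $\mu_{(s,t)}\colon\mathscr D(U_1,U_2)\otimes\mathscr D(V_1,V_2)\to\mathscr D((U_1\setminus\{s\})\amalg V_1,U_2\amalg(V_2\setminus\{t\}))$ for $s\in U_1,t\in V_2$; put $\mu_{(s,t)}(a\otimes b):=\mu_{(s,t)}(b\otimes a)$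 when $s\in V_1,t\in U_2$. Associativity: if $p$ is a walled pair linking $a$ and $b$ (one coordinate in the label set of each) and $q$ is a walled pair disjoint from $p$ linking $b$ and $c$, then $\mu_q(\mu_p(a\otimes b)\otimes c)=\mu_p(a\otimes\mu_q(b\otimes c))$. Morphisms are morphisms of $\Bbbk(\mathsf{FB}\times\mathsf{FB})$-modules compatible with the $\mu_{(s,t)}$. **Contractions.** Let $a_k\in\mathscr D(X_k,Y_k)$, $X=\amalg X_k$, $Y=\amalg Y_k$, and $s\in X_i$, $t\in Y_j$. If $i=j$ the contraction $c_{(s,t)}$ of $a_1\cdots a_r$ (resp. $a_1\wedge\dots\wedge a_r$) is $0$. If $i\neq j$: on $S_\circledcirc^*\mathscr D$, $c_{(s,t)}(a_1\cdots a_r)=\big(\prod_{k\ne i,j}a_k\big)\mu_{(s,t)}(a_i\otimes a_j)$; on $\Lambda_\circledcirc^*\mathscr D$, write $a_1\wedge\dots\wedge a_r=\sigma\,\omega\wedge a_i\wedge a_j$ with $\sigma=\pm1$ and $\omega$ the product of the other factors, and $c_{(s,t)}(a_1\wedge\dots\wedge a_r)=\sigma\,\omega\wedge\mu_{(s,t)}(a_i\otimes a_j)$. *)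

(* Defs.v *)
From HB Require Import structures.
From mathcomp Require Import all_boot all_order all_algebra all_fingroup.
From mathcomp Require Import boolp.

Set Implicit Arguments.
Unset Strict Implicit.
Unset Printing Implicit Defensive.

Import GRing.Theory.
Local Open Scope ring_scope.
Local Open Scope quotient_scope.

Section LinearFacts.
Context {k : fieldType} {U V : lmodType k}.
Variable (f : U -> V).
Hypothesis f_lin : linear f.

Let F : {linear U -> V} := HB.pack f (GRing.isLinear.Build k U V *:%R f f_lin).

Lemma lin0 : f 0 = 0. Proof. exact: (raddf0 F). Qed.
Lemma linD x y : f (x + y) = f x + f y. Proof. exact: (raddfD F). Qed.
Lemma linN x : f (- x) = - f x. Proof. exact: (raddfN F). Qed.
Lemma linB x y : f (x - y) = f x - f y. Proof. exact: (raddfB F). Qed.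
Lemma linZ c x : f (c *: x) = c *: f x. Proof. exact: (linearZZ F). Qed.
Lemma lin_sum (I : Type) (r : seq I) (P : pred I) (E : I -> U) :
  f (\sum_(i <- r | P i) E i) = \sum_(i <- r | P i) f (E i).
Proof. exact: (raddf_sum F). Qed.
End LinearFacts.

Lemma lin_comp (k : fieldType) (U V W : lmodType k) (g : V -> W) (f : U -> V) :
  linear g -> linear f -> linear (g \o f).
Proof. by move=> hg hf a u v; rewrite /= hf hg. Qed.

Lemma lin_id (k : fieldType) (U : lmodType k) : linear (@id U).
Proof. by []. Qed.

Section DirectSum.
Context {k : fieldType} {I : choiceType}.
Variable V : I -> lmodType k.

Record dsum := DSum {
  dsum_fun :> forall i, V i;
  dsum_supp : exists s : seq I, forall i, i \notin s -> dsum_fun i = 0 }.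

HB.instance Definition _ := gen_eqMixin dsum.
HB.instance Definition _ := gen_choiceMixin dsum.

Lemma dsum_eq (x y : dsum) : (forall i, x i = y i) -> x = y.
Proof.
case: x y => [x hx] [y hy] /= e.
have {}e : x = y by apply: functional_extensionality_dep.
by subst y; congr DSum; apply: Prop_irrelevance.
Qed.

Lemma dsum_zero_subproof :
  exists s : seq I, forall i, i \notin s -> (0 : V i) = 0.
Proof. by exists [::]. Qed.
Definition dsum_zero := @DSum (fun i => 0) dsum_zero_subproof.

Lemma dsum_add_subproof (x y : dsum) :
  exists s : seq I, forall i, i \notin s -> x i + y i = 0.
Proof.
case: (dsum_supp x) (dsum_supp y) => [s hs] [t ht]; exists (s ++ t) => i.
by rewrite mem_cat negb_or => /andP[/hs -> /ht ->]; rewrite addr0.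
Qed.
Definition dsum_add x y := DSum (dsum_add_subproof x y).

Lemma dsum_scale_subproof (c : k) (x : dsum) :
  exists s : seq I, forall i, i \notin s -> c *: x i = 0.
Proof.
by case: (dsum_supp x) => [s hs]; exists s => i /hs ->; rewrite scaler0.
Qed.
Definition dsum_scale c x := DSum (dsum_scale_subproof c x).

Lemma dsum_opp_subproof (x : dsum) :
  exists s : seq I, forall i, i \notin s -> - x i = 0.
Proof.
by case: (dsum_supp x) => [s hs]; exists s => i /hs ->; rewrite oppr0.
Qed.
Definition dsum_opp x := DSum (dsum_opp_subproof x).

Lemma dsum_addA : associative dsum_add.
Proof. by move=> x y z; apply: dsum_eq => i /=; rewrite addrA. Qed.
Lemma dsum_addC : commutative dsum_add.
Proof. by move=> x y; apply: dsum_eq => i /=; rewrite addrC. Qed.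
Lemma dsum_add0 : left_id dsum_zero dsum_add.
Proof. by move=> x; apply: dsum_eq => i /=; rewrite add0r. Qed.
Lemma dsum_addN : left_inverse dsum_zero dsum_opp dsum_add.
Proof. by move=> x; apply: dsum_eq => i /=; rewrite addNr. Qed.

HB.instance Definition _ :=
  GRing.isZmodule.Build dsum dsum_addA dsum_addC dsum_add0 dsum_addN.

Lemma dsum_scaleA a b x : dsum_scale a (dsum_scale b x) = dsum_scale (a * b) x.
Proof. by apply: dsum_eq => i /=; rewrite scalerA. Qed.
Lemma dsum_scale1 : left_id 1 dsum_scale.
Proof. by move=> x; apply: dsum_eq => i /=; rewrite scale1r. Qed.
Lemma dsum_scaleDr : right_distributive dsum_scale +%R.
Proof. by move=> a x y; apply: dsum_eq => i /=; rewrite scalerDr. Qed.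
Lemma dsum_scaleDl x : {morph dsum_scale^~ x : a b / a + b}.
Proof. by move=> a b; apply: dsum_eq => i /=; rewrite scalerDl. Qed.

HB.instance Definition _ := GRing.Zmodule_isLmodule.Build k dsum
  dsum_scaleA dsum_scale1 dsum_scaleDr dsum_scaleDl.

Lemma dsum_zeroE i : (0 : dsum) i = 0. Proof. by []. Qed.
Lemma dsum_addE (x y : dsum) i : (x + y) i = x i + y i. Proof. by []. Qed.
Lemma dsum_scaleE c (x : dsum) i : (c *: x) i = c *: x i. Proof. by []. Qed.
Lemma dsum_sumE (J : Type) (r : seq J) (P : pred J) (E : J -> dsum) i :
  (\sum_(j <- r | P j) E j) i = \sum_(j <- r | P j) E j i.
Proof. by elim/big_rec2: _ => // j x y _ <-. Qed.

Lemma din_subproof i (v : V i) :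
  exists s : seq I, forall j, j \notin s -> dfwith (fun j => 0 : V j) v j = 0.
Proof.
by exists [:: i] => j; rewrite inE eq_sym => h; rewrite dfwith_out.
Qed.
Definition din i (v : V i) : dsum := DSum (din_subproof v).

Lemma din_lin i : linear (@din i).
Proof.
move=> a u v; apply: dsum_eq => j; rewrite -[RHS]/(a *: din u j + din v j) /=.
case: (eqVneq i j) => [e|ne]; last by rewrite !dfwith_out // scaler0 addr0.
by case: j / e; rewrite !dfwith_in.
Qed.

Section Lift.
Context {W : lmodType k}.
Variable phi : forall i, V i -> W.

(* the linear map that is phi i on the i-th summand (for linear phi i) *)
Definition dlift (x : dsum) : W :=
  \sum_(i <- undup (sval (cid (dsum_supp x)))) phi (x i).

Hypothesis phi_lin : forall i, linear (@phi i).

Lemma dliftE (s : seq I) (x : dsum) :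
  uniq s -> (forall i, i \notin s -> x i = 0) ->
  dlift x = \sum_(i <- s) phi (x i).
Proof.
move=> us hs; rewrite /dlift; case: cid => t ht /=.
have aux (r : seq I) : \sum_(i <- r) phi (x i)
    = \sum_(i <- [seq i <- r | x i != 0]) phi (x i).
  rewrite big_filter [LHS](bigID (fun i => x i != 0)) /=.
  rewrite [X in _ + X]big1 ?addr0 // => i; rewrite negbK => /eqP ->.
  exact: lin0.
rewrite aux [RHS]aux; apply: perm_big; apply: uniq_perm.
- exact/filter_uniq/undup_uniq.
- exact: filter_uniq.
move=> i; rewrite !mem_filter mem_undup; case: eqVneq => //= nz.
by apply/idP/idP => _; apply/negP => /negP; [move/hs|move/ht] => e;
  rewrite e eqxx in nz.
Qed.

Lemma dlift_lin : linear dlift.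
Proof.
move=> a x y.
case: (dsum_supp x) (dsum_supp y) => [s hs] [t ht].
pose r := undup (s ++ t).
have hx i : i \notin r -> x i = 0.
  by rewrite mem_undup mem_cat negb_or => /andP[/hs].
have hy i : i \notin r -> y i = 0.
  by rewrite mem_undup mem_cat negb_or => /andP[_ /ht].
rewrite (@dliftE r) ?undup_uniq //; last first.
  move=> i hi; rewrite -[LHS]/(a *: x i + y i).
  by rewrite hx // hy // scaler0 addr0.
rewrite (dliftE _ hx) ?undup_uniq // (dliftE _ hy) ?undup_uniq //.
rewrite scaler_sumr -big_split /=; apply: eq_bigr => i _.
by rewrite -phi_lin.
Qed.

Lemma dlift_din i (v : V i) : dlift (din v) = phi v.
Proof.
rewrite (@dliftE [:: i]) // ?big_seq1 /= ?dfwith_in // => j.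
by rewrite inE eq_sym => h; rewrite /= dfwith_out.
Qed.
End Lift.

Lemma dsum_sum (x : dsum) : exists s, x = \sum_(i <- s) din (x i).
Proof.
case: (dsum_supp x) => s hs; exists (undup s); apply: dsum_eq => j.
rewrite dsum_sumE; case: (boolP (j \in undup s)) => hj.
  rewrite (bigD1_seq j) ?undup_uniq //= dfwith_in big1 ?addr0 // => i ne.
  by rewrite dfwith_out.
rewrite hs -?(mem_undup s) // big_seq big1 // => i hi; rewrite /= dfwith_out //.
by apply: contraNneq hj => <-.
Qed.

Lemma dsum_ext (W : lmodType k) (f g : dsum -> W) :
  linear f -> linear g -> (forall i (v : V i), f (din v) = g (din v)) -> f =1 g.
Proof.
move=> hf hg e x; case: (dsum_sum x) => s ->.
by rewrite !lin_sum //; apply: eq_bigr => i _.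
Qed.
End DirectSum.

Section Free.
Context {k : fieldType}.
Variable T : choiceType.

Definition free : lmodType k := dsum (fun _ : T => k^o : lmodType k).
Definition gen (t : T) : free :=
  din (V := fun _ : T => k^o : lmodType k) (i := t) 1.

Definition flift (W : lmodType k) (h : T -> W) : free -> W :=
  dlift (V := fun _ : T => k^o : lmodType k) (fun t (c : k) => c *: h t).

Lemma flift_lin (W : lmodType k) (h : T -> W) : linear (flift h).
Proof.
by apply: dlift_lin => t a u v; rewrite scalerDl scalerA.
Qed.

Lemma flift_gen (W : lmodType k) (h : T -> W) t : flift h (gen t) = h t.
Proof.
rewrite /flift dlift_din ?scale1r // => {}t a u v.
by rewrite scalerDl scalerA.
Qed.

Lemma free_ext (W : lmodType k) (f g : free -> W) :
  linear f -> linear g -> (forall t, f (gen t) = g (gen t)) -> f =1 g.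
Proof.
move=> hf hg e; apply: dsum_ext => // t c.
have -> : @din k T (fun _ : T => k^o : lmodType k) t c = (c : k) *: gen t.
  have := linZ (@din_lin _ _ (fun _ : T => k^o : lmodType k) t) c 1.
  by have -> : (c : k) *: (1 : k^o) = c by exact: mulr1.
by rewrite (linZ hf) (linZ hg) e.
Qed.
End Free.

Section LinearQuotient.
Context {k : fieldType} {V : lmodType k}.
Variable S : V -> Prop.

Inductive span : V -> Prop :=
| span0 : span 0
| spanZD a u v : S u -> span v -> span (a *: u + v).

Lemma span_sub u : S u -> span u.
Proof. by move=> su; rewrite -[u]scale1r -[_ *: _]addr0; apply: spanZD su span0. Qed.

Lemma spanD u v : span u -> span v -> span (u + v).
Proof.
by elim=> [|a x y sx _ ih] sv; rewrite ?add0r // -addrA; constructor; auto.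
Qed.

Lemma spanZ c u : span u -> span (c *: u).
Proof.
elim=> [|a x y sx _ ih]; first by rewrite scaler0; constructor.
by rewrite scalerDr scalerA; constructor.
Qed.

Definition span_pred : {pred V} := fun v => `[< span v >].

Lemma span_predP v : reflect (span v) (v \in span_pred).
Proof. exact: asboolP. Qed.

Lemma span_zmod_closed : zmod_closed span_pred.
Proof.
split; first by apply/span_predP; constructor.
move=> x y /span_predP hx /span_predP hy; apply/span_predP.
by rewrite -scaleN1r; apply: spanD => //; apply: spanZ.
Qed.

HB.instance Definition _ := GRing.isZmodClosed.Build V span_pred span_zmod_closed.

(* the quotient of V by the subspace spanned by S *)
Definition lquot : Type := Quotient.quot (span_pred : zmodClosed V).

HB.instance Definition _ := GRing.Zmodule.on lquot.

Definition qpi (v : V) : lquot := \pi_(Quotient.quot (span_pred : zmodClosed V)) v.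
Definition qrepr (x : lquot) : V := generic_quotient.repr (x : Quotient.quot (span_pred : zmodClosed V)).

Lemma qreprK : cancel qrepr qpi.
Proof. exact: reprK. Qed.

Lemma qpiP u v : (qpi u = qpi v) <-> span (u - v).
Proof.
split=> [/eqP|h]; last apply/eqP.
  by rewrite /qpi -Quotient.idealrBE => /span_predP.
by rewrite /qpi -Quotient.idealrBE; apply/span_predP.
Qed.

Lemma qpiD u v : qpi (u + v) = qpi u + qpi v.
Proof. by rewrite /qpi raddfD. Qed.

Definition lquot_scale (c : k) (x : lquot) : lquot := qpi (c *: qrepr x).

Lemma lquot_scale_pi c v : lquot_scale c (qpi v) = qpi (c *: v).
Proof.
apply/qpiP; rewrite -scalerBr; apply: spanZ; apply/qpiP; exact: qreprK.
Qed.

Lemma lquot_scaleA a b x : lquot_scale a (lquot_scale b x) = lquot_scale (a * b) x.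
Proof. by rewrite -[x]qreprK !lquot_scale_pi scalerA. Qed.
Lemma lquot_scale1 : left_id 1 lquot_scale.
Proof. by move=> x; rewrite -[x]qreprK !lquot_scale_pi scale1r. Qed.
Lemma lquot_scaleDr : right_distributive lquot_scale +%R.
Proof.
move=> a x y; rewrite -[x]qreprK -[y]qreprK -qpiD !lquot_scale_pi -qpiD.
by rewrite scalerDr.
Qed.
Lemma lquot_scaleDl x : {morph lquot_scale^~ x : a b / a + b}.
Proof. by move=> a b; rewrite -[x]qreprK !lquot_scale_pi -qpiD scalerDl. Qed.

HB.instance Definition _ := GRing.Zmodule_isLmodule.Build k lquot
  lquot_scaleA lquot_scale1 lquot_scaleDr lquot_scaleDl.

Lemma qpi_lin : linear qpi.
Proof. by move=> a u v; rewrite qpiD -lquot_scale_pi. Qed.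

(* the factorization through the quotient of a linear map vanishing on S *)
Definition qlift (W : lmodType k) (f : V -> W) (x : lquot) : W := f (qrepr x).

Lemma qlift_pi (W : lmodType k) (f : V -> W) v :
  linear f -> (forall u, S u -> f u = 0) -> qlift f (qpi v) = f v.
Proof.
move=> hf hS; apply/eqP; rewrite -subr_eq0 -(linB hf); apply/eqP.
have /qpiP : qpi (qrepr (qpi v)) = qpi v by exact: qreprK.
by elim=> [|a x y sx _ ih]; rewrite ?lin0 // hf hS // scaler0 add0r.
Qed.

Lemma qlift_lin (W : lmodType k) (f : V -> W) :
  linear f -> (forall u, S u -> f u = 0) -> linear (qlift f).
Proof.
move=> hf hS a x y; rewrite -[x]qreprK -[y]qreprK -qpi_lin.
by rewrite !qlift_pi // hf.
Qed.

Lemma lquot_ext (W : lmodType k) (f g : lquot -> W) :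
  (forall v, f (qpi v) = g (qpi v)) -> f =1 g.
Proof. by move=> e x; rewrite -[x]qreprK. Qed.
End LinearQuotient.

Section Tensor.
Context {k : fieldType} {I : finType}.
Variable V : I -> lmodType k.

Definition multilinear (W : lmodType k) (h : (forall i, V i) -> W) :=
  forall (a : forall i, V i) i, linear (fun v : V i => h (dfwith a v)).

Definition tens_rel (u : free (forall i, V i)) : Prop :=
  exists (a : forall i, V i) i c (v w : V i),
    u = gen (dfwith a (c *: v + w)) - (c *: gen (dfwith a v) + gen (dfwith a w)).

Definition tens : lmodType k := lquot tens_rel.
Definition ptens (a : forall i, V i) : tens := qpi tens_rel (gen a).

Lemma ptens_mlin : multilinear ptens.
Proof.
move=> a i c v w; rewrite /ptens -qpi_lin; apply/qpiP; apply: span_sub.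
by exists a, i, c, v, w.
Qed.

Definition tlift (W : lmodType k) (h : (forall i, V i) -> W) : tens -> W :=
  qlift (flift h).

Section Lift.
Context {W : lmodType k}.
Variable h : (forall i, V i) -> W.
Hypothesis h_mlin : multilinear h.

Lemma tlift_rel u : tens_rel u -> flift h u = 0.
Proof.
case=> a [i [c [v [w ->]]]].
rewrite (linB (@flift_lin _ _ _ h)) (linD (@flift_lin _ _ _ h)).
by rewrite (linZ (@flift_lin _ _ _ h)) !flift_gen h_mlin subrr.
Qed.

Lemma tlift_lin : linear (tlift h).
Proof. apply: qlift_lin; [exact: flift_lin|exact: tlift_rel]. Qed.

Lemma tlift_ptens a : tlift h (ptens a) = h a.
Proof.
rewrite /tlift qlift_pi ?flift_gen //; [exact: flift_lin|exact: tlift_rel].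
Qed.
End Lift.

Lemma tens_ext (W : lmodType k) (f g : tens -> W) :
  linear f -> linear g -> (forall a, f (ptens a) = g (ptens a)) -> f =1 g.
Proof.
move=> hf hg e; apply: lquot_ext; apply: free_ext => //.
- by move=> a u v; rewrite qpi_lin hf.
- by move=> a u v; rewrite qpi_lin hg.
Qed.
End Tensor.

(* Factors may be permuted along a bijection of the index sets. *)
Lemma mlin_reindex (k : fieldType) (I J : finType) (V : I -> lmodType k)
    (V' : J -> lmodType k) (rho : J -> I) (phi : forall j, V (rho j) -> V' j)
    (W : lmodType k) (h : (forall j, V' j) -> W) :
  bijective rho -> (forall j, linear (@phi j)) -> multilinear h ->
  multilinear (fun a : forall i, V i => h (fun j => phi j (a (rho j)))).
Proof.
move=> brho hphi hh a i; have [rho' K1 K2] := brho.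
have [j e] : exists j, i = rho j by exists (rho' i).
subst i => c v w.
have E x : (fun j' => phi j' (dfwith a x (rho j'))) =
           dfwith (fun j' => phi j' (a (rho j'))) (phi j x).
  apply: functional_extensionality_dep => j'.
  case: (eqVneq j j') => [<-|ne]; first by rewrite !dfwith_in.
  by rewrite !dfwith_out // (inj_eq (bij_inj brho)).
by rewrite !E hphi hh.
Qed.

Record bij (X Y : Type) := Bij {
  bfun :> X -> Y;
  binv : Y -> X;
  bijK : cancel bfun binv;
  binvK : cancel binv bfun }.

Lemma bij_eq (X Y : Type) (f g : bij X Y) : f =1 g -> f = g.
Proof.
case: f g => [f f' fK f'K] [g g' gK g'K] /= e.
have {}e : f = g by apply: functional_extensionality_dep.
subst g; have e' : f' = g'.
  by apply: functional_extensionality_dep => y; rewrite -[y in LHS]g'K fK.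
by subst g'; congr Bij; apply: Prop_irrelevance.
Qed.

Lemma bij_bijective (X Y : Type) (f : bij X Y) : bijective f.
Proof. by exists (binv f); [exact: bijK|exact: binvK]. Qed.

Definition bij_id (X : Type) : bij X X := @Bij X X id id (fun=> erefl) (fun=> erefl).

Definition bij_comp (X Y Z : Type) (g : bij Y Z) (f : bij X Y) : bij X Z :=
  @Bij X Z (g \o f) (binv f \o binv g)
    (can_comp (bijK g) (bijK f)) (can_comp (binvK f) (binvK g)).

Lemma bij_compE (X Y Z : Type) (g : bij Y Z) (f : bij X Y) x :
  bij_comp g f x = g (f x).
Proof. by []. Qed.

Definition bij_sym (X Y : Type) (f : bij X Y) : bij Y X :=
  Bij (binvK f) (bijK f).

Lemma bij_sum_subproof (X Y X' Y' : Type) (f : bij X X') (g : bij Y Y') :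
  let h (X Y X' Y' : Type) (f : X -> X') (g : Y -> Y') (z : X + Y) :=
    match z with inl x => inl (f x) | inr y => inr (g y) end in
  cancel (h _ _ _ _ f g) (h _ _ _ _ (binv f) (binv g)) /\
  cancel (h _ _ _ _ (binv f) (binv g)) (h _ _ _ _ f g).
Proof. by split; case=> z /=; rewrite ?bijK ?binvK. Qed.

Definition bij_sum (X Y X' Y' : Type) (f : bij X X') (g : bij Y Y') :
    bij (X + Y) (X' + Y') :=
  Bij (bij_sum_subproof f g).1 (bij_sum_subproof f g).2.

Definition rem (X : finType) (s : X) : finType := {x : X | x != s}.

Definition rem_elt (X : finType) (s x : X) (h : x != s) : rem s :=
  exist (fun y => y != s) x h.

Lemma bij_rem_subproof (X X' : finType) (f : bij X X') (s : X) (x : rem s) :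
  f (val x) != f s.
Proof. by rewrite (inj_eq (can_inj (bijK f))); exact: (valP x). Qed.

Lemma bij_rem_subproof' (X X' : finType) (f : bij X X') (s : X) (y : rem (f s)) :
  binv f (val y) != s.
Proof. by rewrite -(inj_eq (can_inj (bijK f))) binvK; exact: (valP y). Qed.

Lemma bij_rem_subproofK (X X' : finType) (f : bij X X') (s : X) :
  cancel (fun x : rem s => rem_elt (bij_rem_subproof f x) : rem (f s))
         (fun y => rem_elt (bij_rem_subproof' y)).
Proof. by move=> x; apply: val_inj => /=; rewrite bijK. Qed.

Lemma bij_rem_subproofK' (X X' : finType) (f : bij X X') (s : X) :
  cancel (fun y : rem (f s) => rem_elt (bij_rem_subproof' y) : rem s)
         (fun x => rem_elt (bij_rem_subproof f x)).
Proof. by move=> x; apply: val_inj => /=; rewrite binvK. Qed.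

Definition bij_rem (X X' : finType) (f : bij X X') (s : X) : bij (rem s) (rem (f s)) :=
  Bij (@bij_rem_subproofK _ _ f s) (@bij_rem_subproofK' _ _ f s).

(* If u : P -> A and v : Q -> A are injective labellings with the same image,
   the unique bijection P -> Q preserving the labels. *)
Section Relabel.
Context {P Q A : Type}.
Variables (u : P -> A) (v : Q -> A).
Hypotheses (u_inj : injective u) (v_inj : injective v).
Hypotheses (uv : forall p, exists q, v q = u p) (vu : forall q, exists p, u p = v q).

Lemma relabel_subproof : cancel (fun p => sval (cid (uv p))) (fun q => sval (cid (vu q))).
Proof. by move=> p; apply: u_inj; rewrite (proj2_sig (cid (vu _))) (proj2_sig (cid (uv p))). Qed.

Lemma relabel_subproof' : cancel (fun q => sval (cid (vu q))) (fun p => sval (cid (uv p))).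
Proof. by move=> q; apply: v_inj; rewrite (proj2_sig (cid (uv _))) (proj2_sig (cid (vu q))). Qed.

Definition relabel : bij P Q := Bij relabel_subproof relabel_subproof'.

Lemma relabelE p : v (relabel p) = u p.
Proof. by rewrite /=; case: cid. Qed.
End Relabel.

Section FBModules.
Variable k : fieldType.

Record FBmod := {
  fbob :> finType -> finType -> lmodType k;
  fbact : forall X Y X' Y' : finType,
    bij X X' -> bij Y Y' -> fbob X Y -> fbob X' Y';
  fbact_lin : forall (X Y X' Y' : finType) (a : bij X X') (b : bij Y Y'),
    linear (fbact a b);
  fbact_id : forall (X Y : finType) (x : fbob X Y),
    fbact (bij_id X) (bij_id Y) x = x;
  fbact_comp : forall (X Y X' Y' X'' Y'' : finType)
    (a' : bij X' X'') (b' : bij Y' Y'') (a : bij X X') (b : bij Y Y') x,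
    fbact (bij_comp a' a) (bij_comp b' b) x = fbact a' b' (fbact a b x) }.

Record FBhom (M N : FBmod) := {
  fbh :> forall X Y : finType, M X Y -> N X Y;
  fbh_lin : forall X Y : finType, linear (@fbh X Y);
  fbh_nat : forall (X Y X' Y' : finType) (a : bij X X') (b : bij Y Y') x,
    fbh (fbact a b x) = fbact a b (fbh x) }.

Lemma FBhom_eq (M N : FBmod) (f g : FBhom M N) :
  (forall (X Y : finType) (x : M X Y), f X Y x = g X Y x) -> f = g.
Proof.
case: f g => [f fl fn] [g gl gn] /= e.
have {}e : f = g by do 3!apply: functional_extensionality_dep => ?.
by subst g; congr Build_FBhom; apply: Prop_irrelevance.
Qed.

Lemma FBhom_id_subproof (M : FBmod) (X Y X' Y' : finType) (a : bij X X')
  (b : bij Y Y') (x : M X Y) : id (fbact a b x) = fbact a b (id x).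
Proof. by []. Qed.

Definition FBhom_id (M : FBmod) : FBhom M M :=
  {| fbh := fun X Y => id; fbh_lin := fun X Y => @lin_id _ _;
     fbh_nat := @FBhom_id_subproof M |}.

Lemma FBhom_comp_subproof (M N L : FBmod) (g : FBhom N L) (f : FBhom M N)
    (X Y X' Y' : finType) (a : bij X X') (b : bij Y Y') (x : M X Y) :
  (@fbh _ _ g X' Y' \o @fbh _ _ f X' Y') (fbact a b x)
    = fbact a b ((@fbh _ _ g X Y \o @fbh _ _ f X Y) x).
Proof. by rewrite /= !fbh_nat. Qed.

Definition FBhom_comp (M N L : FBmod) (g : FBhom N L) (f : FBhom M N) : FBhom M L :=
  {| fbh := fun X Y => @fbh _ _ g X Y \o @fbh _ _ f X Y;
     fbh_lin := fun X Y => lin_comp (@fbh_lin _ _ g X Y) (@fbh_lin _ _ f X Y);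
     fbh_nat := FBhom_comp_subproof g f |}.

Lemma fbact_eq (M : FBmod) (X Y X' Y' : finType) (a a' : bij X X')
    (b b' : bij Y Y') (x : M X Y) :
  a =1 a' -> b =1 b' -> fbact a b x = fbact a' b' x.
Proof. by move=> /bij_eq -> /bij_eq ->. Qed.
End FBModules.

Inductive sign := Plus | Minus.

Definition sgn (k : fieldType) (d : sign) (n : nat) (s : 'S_n) : k :=
  if d is Minus then (-1) ^+ s else 1.

(* A decomposition of X into r pieces is given by f : X -> 'I_r, the piece of
   index i being the fibre of f over i. *)
Definition fib (X : finType) (r : nat) (f : {ffun X -> 'I_r}) (i : 'I_r) : finType :=
  {x : X | f x == i}.

Definition fib_elt (X : finType) (r : nat) (f : {ffun X -> 'I_r}) (i : 'I_r) (x : X)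
    (h : f x == i) : fib f i :=
  exist (fun y => f y == i) x h.

Lemma fib_bij_inj (X X' : finType) (al : bij X X') (r : nat) (f : {ffun X -> 'I_r}) i :
  injective (fun x : fib f i => al (val x)).
Proof. by move=> x y /(can_inj (bijK al)) /val_inj. Qed.

Section FibBij.
Context {X X' : finType} {r r' : nat}.
Variables (al : bij X X') (f : {ffun X -> 'I_r}) (f' : {ffun X' -> 'I_r'}).
Variables (i : 'I_r) (i' : 'I_r').
Hypothesis ff' : forall x, (f' (al x) == i') = (f x == i).

Lemma fib_bij_subproof (p : fib f i) :
  exists q : fib f' i', val q = al (val p).
Proof.
have h : f' (al (val p)) == i' by rewrite ff'; exact: (valP p).
by exists (fib_elt h).
Qed.

Lemma fib_bij_subproof' (q : fib f' i') :
  exists p : fib f i, al (val p) = val q.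
Proof.
have h : f (binv al (val q)) == i by rewrite -ff' binvK; exact: (valP q).
by exists (fib_elt h); rewrite /= binvK.
Qed.

Definition fib_bij : bij (fib f i) (fib f' i') :=
  relabel (@fib_bij_inj _ _ al _ f i) val_inj fib_bij_subproof fib_bij_subproof'.

Lemma fib_bijE p : val (fib_bij p) = al (val p).
Proof. exact: relabelE. Qed.
End FibBij.

Section Convolution.
Context {k : fieldType}.
Variables (r : nat) (G : FBmod k) (X Y : finType).

Definition decomp : Type := ({ffun X -> 'I_r} * {ffun Y -> 'I_r})%type.

(* tuples (a_i) with a_i in G(X_i, Y_i) *)
Definition decor (fg : decomp) := forall i : 'I_r, G (fib fg.1 i) (fib fg.2 i).

(* the r-fold convolution power of G at (X, Y) *)
Definition convpow : lmodType k :=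
  dsum (fun fg : decomp => tens (fun i : 'I_r => G (fib fg.1 i) (fib fg.2 i))).

Definition cpure (fg : decomp) (a : decor fg) : convpow :=
  din (V := fun fg : decomp => tens (fun i : 'I_r => G (fib fg.1 i) (fib fg.2 i)))
    (ptens a).

Definition clift (W : lmodType k) (h : forall fg : decomp, decor fg -> W) :
    convpow -> W :=
  dlift (V := fun fg : decomp => tens (fun i : 'I_r => G (fib fg.1 i) (fib fg.2 i)))
    (fun fg => tlift (@h fg)).

Lemma cpure_mlin fg : multilinear (@cpure fg).
Proof. by move=> a i c v w; rewrite /cpure ptens_mlin din_lin. Qed.

Section Lift.
Context {W : lmodType k}.
Variable h : forall fg : decomp, decor fg -> W.
Hypothesis h_mlin : forall fg, multilinear (@h fg).

Lemma clift_lin : linear (clift h).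
Proof. by apply: dlift_lin => fg; apply: tlift_lin. Qed.

Lemma clift_pure fg (a : decor fg) : clift h (cpure a) = h a.
Proof.
rewrite /clift /cpure dlift_din ?tlift_ptens // => fg'; exact: tlift_lin.
Qed.
End Lift.

Lemma convpow_ext (W : lmodType k) (f g : convpow -> W) :
  linear f -> linear g ->
  (forall fg (a : decor fg), f (cpure a) = g (cpure a)) -> f =1 g.
Proof.
move=> hf hg e; apply: dsum_ext => // fg; apply: tens_ext => //.
- by move=> a u v; rewrite din_lin hf.
- by move=> a u v; rewrite din_lin hg.
- by move=> a; apply: e.
Qed.
End Convolution.

(* the action of 'S_r on the r-fold convolution power: the new i-th factor is
   the old (s^-1 i)-th one, and its labels do not change *)
Section PermAction.
Context {k : fieldType}.
Variables (r : nat) (G : FBmod k) (X Y : finType).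
Variable s : 'S_r.

Definition perm_dec (Z : finType) (f : {ffun Z -> 'I_r}) : {ffun Z -> 'I_r} :=
  [ffun z => s (f z)].

Lemma perm_dec_fib (Z : finType) (f : {ffun Z -> 'I_r}) i z :
  (perm_dec f (bij_id Z z) == i) = (f z == (s^-1)%g i).
Proof. by rewrite ffunE /=; apply/eqP/eqP => [<-|->]; rewrite ?permK ?permKV. Qed.

Definition perm_decomp (fg : decomp r X Y) : decomp r X Y :=
  (perm_dec fg.1, perm_dec fg.2).

Definition perm_decor (fg : decomp r X Y) (a : decor G fg) : decor G (perm_decomp fg) :=
  fun i => fbact (fib_bij (perm_dec_fib fg.1 i)) (fib_bij (perm_dec_fib fg.2 i))
                 (a ((s^-1)%g i)).

Definition perm_act : convpow r G X Y -> convpow r G X Y :=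
  clift (fun fg a => cpure (perm_decor a)).

Lemma perm_mlin fg : multilinear (fun a : decor G fg => cpure (perm_decor a)).
Proof.
pose phi i := fbact (f := G) (fib_bij (perm_dec_fib fg.1 i)) (fib_bij (perm_dec_fib fg.2 i)).
apply: (mlin_reindex (V' := fun i => G (fib (perm_dec fg.1) i) (fib (perm_dec fg.2) i))
   (rho := fun i => (s^-1)%g i) (phi := phi)).
- exact/injF_bij/perm_inj.
- by move=> i; apply: fbact_lin.
- exact: (@cpure_mlin _ r G X Y (perm_decomp fg)).
Qed.
End PermAction.

Section Power.
Context {k : fieldType}.
Variables (d : sign) (G : FBmod k).

Definition coinv_rel r (X Y : finType) (u : convpow r G X Y) : Prop :=
  exists (s : 'S_r) v, u = perm_act s v - sgn k d s *: v.

(* the r-th symmetric (d = Plus) or exterior (d = Minus) power: coinvariants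
   of 'S_r in the r-fold convolution power twisted by the trivial or sign
   character *)
Definition rpow r (X Y : finType) : lmodType k := lquot (@coinv_rel r X Y).

Definition pow (X Y : finType) : lmodType k := dsum (fun r : nat => rpow r X Y).

Definition cls (r : nat) (X Y : finType) (fg : decomp r X Y) (a : decor G fg) : pow X Y :=
  din (V := fun r : nat => rpow r X Y) (qpi (@coinv_rel r X Y) (cpure a)).

Definition pow_lift (X Y : finType) (W : lmodType k)
    (h : forall r (fg : decomp r X Y), decor G fg -> W) : pow X Y -> W :=
  dlift (V := fun r : nat => rpow r X Y) (fun r => qlift (clift (@h r))).

Lemma cls_mlin (r : nat) (X Y : finType) (fg : decomp r X Y) :
  multilinear (@cls r X Y fg).
Proof.
by move=> a i c v w; rewrite /cls (cpure_mlin (fg := fg)) qpi_lin din_lin.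
Qed.

Lemma cls_perm (r : nat) (X Y : finType) (s : 'S_r) (fg : decomp r X Y) (a : decor G fg) :
  cls (perm_decor s a) = sgn k d s *: cls a.
Proof.
rewrite /cls -(linZ (@din_lin _ _ (fun r : nat => rpow r X Y) r)).
rewrite -(linZ (@qpi_lin _ _ _)); congr din; apply/qpiP; apply: span_sub.
exists s, (cpure a); rewrite /perm_act clift_pure //.
by move=> fg'; apply: perm_mlin.
Qed.

Section Lift.
Context {X Y : finType} {W : lmodType k}.
Variable h : forall r (fg : decomp r X Y), decor G fg -> W.
Hypothesis h_mlin : forall r fg, multilinear (@h r fg).
Hypothesis h_perm : forall r (s : 'S_r) fg (a : decor G fg),
  h (perm_decor s a) = sgn k d s *: h a.

Lemma pow_lift_rel r (u : convpow r G X Y) : coinv_rel u -> clift (@h r) u = 0.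
Proof.
have hl := @clift_lin _ r G X Y W (@h r) (@h_mlin r).
case=> s [v ->]; rewrite (linB hl) (linZ hl); apply/eqP; rewrite subr_eq0; apply/eqP.
move: v; apply: convpow_ext.
- have pl : linear (@perm_act k r G X Y s).
    by apply: clift_lin => fg; apply: perm_mlin.
  exact: (lin_comp hl pl).
- by move=> a u' v; rewrite hl scalerDr !scalerA mulrC.
- move=> fg a; rewrite /perm_act !clift_pure ?h_perm //.
  by move=> fg'; apply: perm_mlin.
Qed.

Lemma pow_lift_lin : linear (pow_lift h).
Proof.
apply: dlift_lin => r; apply: qlift_lin; last exact: pow_lift_rel.
exact: clift_lin.
Qed.

Lemma pow_lift_cls r (fg : decomp r X Y) (a : decor G fg) : pow_lift h (cls a) = h a.
Proof.
have hl r' := @clift_lin _ r' G X Y W (@h r') (@h_mlin r').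
rewrite /pow_lift /cls dlift_din; last first.
  by move=> r'; apply: qlift_lin => //; exact: pow_lift_rel.
by rewrite qlift_pi ?clift_pure //; exact: pow_lift_rel.
Qed.
End Lift.

Lemma pow_ext (X Y : finType) (W : lmodType k) (f g : pow X Y -> W) :
  linear f -> linear g ->
  (forall r (fg : decomp r X Y) (a : decor G fg), f (cls a) = g (cls a)) -> f =1 g.
Proof.
move=> hf hg e; apply: dsum_ext => // r; apply: lquot_ext; apply: convpow_ext => //.
- by move=> a u v; rewrite qpi_lin din_lin hf.
- by move=> a u v; rewrite qpi_lin din_lin hg.
- by move=> fg a; apply: e.
Qed.
End Power.

Lemma cls_eq (k : fieldType) (d : sign) (G : FBmod k) (r : nat) (X Y : finType)
    (fg fg' : decomp r X Y) (a : decor G fg) (a' : decor G fg') :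
  fg = fg' ->
  (forall i (b1 : bij (fib fg.1 i) (fib fg'.1 i)) (b2 : bij (fib fg.2 i) (fib fg'.2 i)),
    (forall p, val (b1 p) = val p) -> (forall p, val (b2 p) = val p) ->
    fbact b1 b2 (a i) = a' i) ->
  cls d a = cls d a'.
Proof.
move=> e; case: fg' / e a' => a' h; congr cls.
apply: functional_extensionality_dep => i.
by rewrite -(h i (bij_id _) (bij_id _)) // fbact_id.
Qed.

Section PowerAction.
Context {k : fieldType}.
Variables (d : sign) (G : FBmod k).

Section Action.
Context {X Y X' Y' : finType}.
Variables (al : bij X X') (be : bij Y Y').

Definition tr_dec (Z Z' : finType) (r : nat) (ga : bij Z Z') (f : {ffun Z -> 'I_r}) :
    {ffun Z' -> 'I_r} :=
  [ffun z => f (binv ga z)].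

Lemma tr_dec_fib (Z Z' : finType) (r : nat) (ga : bij Z Z') (f : {ffun Z -> 'I_r}) i z :
  (tr_dec ga f (ga z) == i) = (f z == i).
Proof. by rewrite ffunE bijK. Qed.

Definition tr_decomp r (fg : decomp r X Y) : decomp r X' Y' :=
  (tr_dec al fg.1, tr_dec be fg.2).

Definition tr_decor r (fg : decomp r X Y) (a : decor G fg) : decor G (tr_decomp fg) :=
  fun i => fbact (fib_bij (tr_dec_fib al fg.1 i)) (fib_bij (tr_dec_fib be fg.2 i)) (a i).

(* a_1 ... a_r |-> (al, be)(a_1) ... (al, be)(a_r) *)
Definition pow_act : pow d G X Y -> pow d G X' Y' :=
  pow_lift (fun r fg a => cls d (tr_decor a)).

Lemma tr_mlin r (fg : decomp r X Y) :
  multilinear (fun a : decor G fg => cls d (tr_decor a)).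
Proof.
pose phi i := fbact (f := G) (fib_bij (tr_dec_fib al fg.1 i)) (fib_bij (tr_dec_fib be fg.2 i)).
apply: (mlin_reindex (V' := fun i => G (fib (tr_dec al fg.1) i) (fib (tr_dec be fg.2) i))
   (rho := id) (phi := phi)).
- by exists id.
- by move=> i; apply: fbact_lin.
- exact: (@cls_mlin _ d G r X' Y' (tr_decomp fg)).
Qed.

Lemma tr_perm r (s : 'S_r) (fg : decomp r X Y) (a : decor G fg) :
  cls d (tr_decor (perm_decor s a)) = sgn k d s *: cls d (tr_decor a).
Proof.
rewrite -cls_perm; apply: cls_eq.
  by congr pair; apply/ffunP => z; rewrite !ffunE.
move=> i b1 b2 h1 h2; rewrite /tr_decor /perm_decor -!fbact_comp.
by apply: fbact_eq => p; apply: val_inj; rewrite !bij_compE ?h1 ?h2 !fib_bijE.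
Qed.

Lemma pow_act_lin : linear pow_act.
Proof. by apply: pow_lift_lin; [exact: tr_mlin|exact: tr_perm]. Qed.

Lemma pow_act_cls r (fg : decomp r X Y) (a : decor G fg) :
  pow_act (cls d a) = cls d (tr_decor a).
Proof. by rewrite /pow_act pow_lift_cls; [|exact: tr_mlin|exact: tr_perm]. Qed.
End Action.

Lemma pow_act_id (X Y : finType) (x : pow d G X Y) :
  pow_act (bij_id X) (bij_id Y) x = x.
Proof.
move: x; apply: pow_ext; [exact: pow_act_lin|exact: lin_id|move=> r fg a].
rewrite pow_act_cls; apply: cls_eq.
  by case: fg a => f g a; congr pair; apply/ffunP => z; rewrite !ffunE.
move=> i b1 b2 h1 h2; rewrite /tr_decor -fbact_comp -[RHS]fbact_id.
by apply: fbact_eq => p; apply: val_inj; rewrite bij_compE ?h1 ?h2 fib_bijE.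
Qed.

Lemma pow_act_comp (X Y X' Y' X'' Y'' : finType)
    (a' : bij X' X'') (b' : bij Y' Y'') (a : bij X X') (b : bij Y Y')
    (x : pow d G X Y) :
  pow_act (bij_comp a' a) (bij_comp b' b) x = pow_act a' b' (pow_act a b x).
Proof.
move: x; apply: pow_ext.
- exact: pow_act_lin.
- exact: (lin_comp (pow_act_lin a' b') (pow_act_lin a b)).
move=> r fg u; rewrite !pow_act_cls; apply: cls_eq.
  by congr pair; apply/ffunP => z; rewrite !ffunE.
move=> i b1 b2 h1 h2; rewrite /tr_decor -!fbact_comp.
by apply: fbact_eq => p; apply: val_inj; rewrite !bij_compE ?h1 ?h2 !fib_bijE.
Qed.

Definition powFB : FBmod k :=
  {| fbob := fun X Y => pow d G X Y;
     fbact := @pow_act;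
     fbact_lin := @pow_act_lin;
     fbact_id := pow_act_id;
     fbact_comp := pow_act_comp |}.
End PowerAction.

Section PowerMap.
Context {k : fieldType}.
Variables (d : sign) (G H : FBmod k) (h : FBhom G H).

Definition map_decor r (X Y : finType) (fg : decomp r X Y) (a : decor G fg) : decor H fg :=
  fun i => h _ _ (a i).

(* a_1 ... a_r |-> h(a_1) ... h(a_r) *)
Definition pow_map (X Y : finType) : pow d G X Y -> pow d H X Y :=
  pow_lift (fun r fg a => cls d (map_decor a)).

Lemma map_mlin r (X Y : finType) (fg : decomp r X Y) :
  multilinear (fun a : decor G fg => cls d (map_decor a)).
Proof.
pose phi i := h (fib fg.1 i) (fib fg.2 i).
apply: (mlin_reindex (V' := fun i => H (fib fg.1 i) (fib fg.2 i))
   (rho := id) (phi := phi)).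
- by exists id.
- by move=> i; apply: fbh_lin.
- exact: (@cls_mlin _ d H r X Y fg).
Qed.

Lemma map_perm r (X Y : finType) (s : 'S_r) (fg : decomp r X Y) (a : decor G fg) :
  cls d (map_decor (perm_decor s a)) = sgn k d s *: cls d (map_decor a).
Proof.
rewrite -cls_perm; congr cls; apply: functional_extensionality_dep => i.
by rewrite /map_decor /perm_decor fbh_nat.
Qed.

Lemma pow_map_lin (X Y : finType) : linear (@pow_map X Y).
Proof. by apply: pow_lift_lin; [move=> *; exact: map_mlin|move=> *; exact: map_perm]. Qed.

Lemma pow_map_cls r (X Y : finType) (fg : decomp r X Y) (a : decor G fg) :
  pow_map (cls d a) = cls d (map_decor a).
Proof.
by rewrite /pow_map pow_lift_cls //; move=> *; [exact: map_mlin|exact: map_perm].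
Qed.

Lemma pow_map_nat (X Y X' Y' : finType) (a : bij X X') (b : bij Y Y') (x : pow d G X Y) :
  pow_map (pow_act a b x) = pow_act a b (pow_map x).
Proof.
move: x; apply: pow_ext.
- exact: (lin_comp (@pow_map_lin X' Y') (pow_act_lin a b)).
- exact: (lin_comp (pow_act_lin a b) (@pow_map_lin X Y)).
move=> r fg u; rewrite pow_act_cls !pow_map_cls pow_act_cls; congr cls.
by apply: functional_extensionality_dep => i; rewrite /map_decor /tr_decor fbh_nat.
Qed.

Definition pow_FBhom : FBhom (powFB d G) (powFB d H) :=
  @Build_FBhom k (powFB d G) (powFB d H) pow_map pow_map_lin pow_map_nat.
End PowerMap.

(* S^* G and Lambda^* G for the convolution product *)
Definition Sconv (k : fieldType) (G : FBmod k) := powFB Plus G.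
Definition Lconv (k : fieldType) (G : FBmod k) := powFB Minus G.

Record category := {
  cob :> Type;
  chom : cob -> cob -> Type;
  catid : forall x, chom x x;
  catcomp : forall x y z, chom y z -> chom x y -> chom x z;
  catcomp1l : forall x y (f : chom x y), catcomp (catid y) f = f;
  catcomp1r : forall x y (f : chom x y), catcomp f (catid x) = f;
  catcompA : forall x y z w (h : chom z w) (g : chom y z) (f : chom x y),
    catcomp h (catcomp g f) = catcomp (catcomp h g) f }.

Record functor_on (C D : category) (F0 : C -> D) := {
  fmap : forall x y : C, chom x y -> chom (F0 x) (F0 y);
  fmap_id : forall x, fmap (catid x) = catid (F0 x);
  fmap_comp : forall x y z (g : chom y z) (f : chom x y),
    fmap (catcomp g f) = catcomp (fmap g) (fmap f) }.

Section LinearCategories.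
Variable k : fieldType.

Record lincat := {
  lob :> Type;
  lhom : lob -> lob -> lmodType k;
  lid : forall x, lhom x x;
  lcomp : forall x y z, lhom y z -> lhom x y -> lhom x z;
  lcomp_linl : forall x y z (f : lhom x y), linear (fun g : lhom y z => lcomp g f);
  lcomp_linr : forall x y z (g : lhom y z), linear (fun f : lhom x y => lcomp g f);
  lcomp1l : forall x y (f : lhom x y), lcomp (lid y) f = f;
  lcomp1r : forall x y (f : lhom x y), lcomp f (lid x) = f;
  lcompA : forall x y z w (h : lhom z w) (g : lhom y z) (f : lhom x y),
    lcomp h (lcomp g f) = lcomp (lcomp h g) f }.

Definition opcat (C : lincat) : lincat :=
  {| lob := lob C;
     lhom := fun x y => @lhom C y x;
     lid := @lid C;
     lcomp := fun x y z g f => lcomp f g;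
     lcomp_linl := fun x y z f => @lcomp_linr C z y x f;
     lcomp_linr := fun x y z g => @lcomp_linl C z y x g;
     lcomp1l := fun x y f => @lcomp1r C y x f;
     lcomp1r := fun x y f => @lcomp1l C y x f;
     lcompA := fun x y z w h g f => esym (@lcompA C w z y x f g h) |}.

(* k-linear functors from C to vector spaces with object map V *)
Record linmod_on (C : lincat) (V : C -> lmodType k) := {
  lact : forall x y : C, lhom x y -> V x -> V y;
  lact_linl : forall (x y : C) (v : V x), linear (fun f : lhom x y => lact f v);
  lact_linr : forall (x y : C) (f : lhom x y), linear (lact f);
  lact_id : forall (x : C) (v : V x), lact (lid x) v = v;
  lact_comp : forall (x y z : C) (g : lhom y z) (f : lhom x y) (v : V x),
    lact (lcomp g f) v = lact g (lact f v) }.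

Record linmod (C : lincat) := LinMod {
  mob :> C -> lmodType k;
  mact : linmod_on mob }.

Record linmod_hom (C : lincat) (M N : linmod C) := {
  mhom :> forall x : C, M x -> N x;
  mhom_lin : forall x : C, linear (@mhom x);
  mhom_nat : forall (x y : C) (f : lhom x y) (v : M x),
    mhom (lact (mact M) f v) = lact (mact N) f (mhom v) }.

Lemma linmod_hom_eq (C : lincat) (M N : linmod C) (f g : linmod_hom M N) :
  (forall (x : C) (v : M x), f x v = g x v) -> f = g.
Proof.
case: f g => [f fl fn] [g gl gn] /= e.
have {}e : f = g by do 2!apply: functional_extensionality_dep => ?.
by subst g; congr Build_linmod_hom; apply: Prop_irrelevance.
Qed.

Lemma linmod_id_subproof (C : lincat) (M : linmod C) (x y : C) (f : lhom x y) (v : M x) :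
  id (lact (mact M) f v) = lact (mact M) f (id v).
Proof. by []. Qed.

Definition linmod_id (C : lincat) (M : linmod C) : linmod_hom M M :=
  {| mhom := fun x => id; mhom_lin := fun x => @lin_id _ _;
     mhom_nat := @linmod_id_subproof C M |}.

Lemma linmod_comp_subproof (C : lincat) (M N L : linmod C) (g : linmod_hom N L)
    (f : linmod_hom M N) (x y : C) (h : lhom x y) (v : M x) :
  (@mhom _ _ _ g y \o @mhom _ _ _ f y) (lact (mact M) h v)
    = lact (mact L) h ((@mhom _ _ _ g x \o @mhom _ _ _ f x) v).
Proof. by rewrite /= !mhom_nat. Qed.

Definition linmod_comp (C : lincat) (M N L : linmod C) (g : linmod_hom N L)
    (f : linmod_hom M N) : linmod_hom M L :=
  {| mhom := fun x => @mhom _ _ _ g x \o @mhom _ _ _ f x;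
     mhom_lin := fun x => lin_comp (@mhom_lin _ _ _ g x) (@mhom_lin _ _ _ f x);
     mhom_nat := linmod_comp_subproof g f |}.

Program Definition Mod (C : lincat) : category :=
  {| cob := linmod C; chom := @linmod_hom C; catid := @linmod_id C;
     catcomp := @linmod_comp C |}.
Next Obligation. by apply: linmod_hom_eq. Qed.
Next Obligation. by apply: linmod_hom_eq. Qed.
Next Obligation. by apply: linmod_hom_eq. Qed.
End LinearCategories.

(* w = (i, j, l) with i : X -> U, j : Y -> V and a list l of n pairs in U x V,
   such that i and the first projections of l (resp. j and the second ones)
   enumerate U (resp. V) without repetition: this is a pair of bijections
   X + {1..n} -> U, Y + {1..n} -> V, and forces |U| - |X| = |V| - |Y| = n. *)
Definition wdiag_ok (X Y U V : finType)
    (w : {ffun X -> U} * {ffun Y -> V} * seq (U * V)) : bool :=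
  perm_eq (codom w.1.1 ++ unzip1 w.2) (enum U) &&
  perm_eq (codom w.1.2 ++ unzip2 w.2) (enum V).

Definition wdiag (X Y U V : finType) : choiceType := {w | @wdiag_ok X Y U V w}.

Section DiagramOps.
Definition winl (X Y U V : finType) (w : wdiag X Y U V) : {ffun X -> U} := (val w).1.1.
Definition winr (X Y U V : finType) (w : wdiag X Y U V) : {ffun Y -> V} := (val w).1.2.
Definition wlst (X Y U V : finType) (w : wdiag X Y U V) : seq (U * V) := (val w).2.

Lemma wdiag_eq (X Y U V : finType) (w w' : wdiag X Y U V) :
  winl w = winl w' -> winr w = winr w' -> wlst w = wlst w' -> w = w'.
Proof.
case: w w' => [[[i j] l] h] [[[i' j'] l'] h']; rewrite /winl /winr /wlst /=.
by move=> e1 e2 e3; apply: val_inj; rewrite /= e1 e2 e3.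
Qed.

Lemma codom_bij (X U : finType) (i : {ffun X -> U}) : bijective i ->
  perm_eq (codom i) (enum U).
Proof.
move=> bi; apply: uniq_perm.
- by rewrite /image_mem map_inj_uniq ?enum_uniq //; exact: bij_inj.
- exact: enum_uniq.
by move=> u; case: bi => j ij ji; rewrite mem_enum -[u]ji codom_f.
Qed.

Lemma codom_ffun (X U : finType) (i : X -> U) : codom [ffun x => i x] = codom i.
Proof. by apply: eq_codom => x; rewrite ffunE. Qed.

Lemma bij_ffun (X X' : finType) (al : bij X X') : bijective [ffun x => al x].
Proof.
by exists (binv al) => x; rewrite ffunE ?bijK ?binvK.
Qed.

Lemma wbij_subproof (X Y X' Y' : finType) (al : bij X X') (be : bij Y Y') :
  wdiag_ok ([ffun x => al x], [ffun y => be y], [::]).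
Proof.
rewrite /wdiag_ok /= !cats0.
by rewrite !codom_bij //; exact: bij_ffun.
Qed.

Definition wbij (X Y X' Y' : finType) (al : bij X X') (be : bij Y Y') :
    wdiag X Y X' Y' :=
  exist (@wdiag_ok X Y X' Y') _ (wbij_subproof al be).

Definition wid (X Y : finType) : wdiag X Y X Y := wbij (bij_id X) (bij_id Y).

Lemma wcomp_half (X U Z : finType) (i : {ffun X -> U}) (l : seq U)
    (i' : {ffun U -> Z}) (l' : seq Z) :
  perm_eq (codom i ++ l) (enum U) -> perm_eq (codom i' ++ l') (enum Z) ->
  perm_eq (codom [ffun x => i' (i x)] ++ ([seq i' u | u <- l] ++ l')) (enum Z).
Proof.
move=> h h'; apply: perm_trans h'; rewrite catA perm_cat2r.
have -> : codom [ffun x => i' (i x)] = map i' (codom i).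
  by rewrite codom_ffun [codom i]/image_mem -map_comp.
by rewrite -map_cat; exact: perm_map.
Qed.

Lemma wcomp_subproof (X Y U V Z W : finType) (g : wdiag U V Z W) (f : wdiag X Y U V) :
  wdiag_ok ([ffun x => winl g (winl f x)], [ffun y => winr g (winr f y)],
            [seq (winl g p.1, winr g p.2) | p <- wlst f] ++ wlst g).
Proof.
case/andP: (valP f) => f1 f2; case/andP: (valP g) => g1 g2.
have h1 := wcomp_half f1 g1; have h2 := wcomp_half f2 g2.
rewrite /wdiag_ok /= /unzip1 /unzip2 !map_cat -!map_comp.
by rewrite -!map_comp in h1 h2; rewrite h1 h2.
Qed.

(* the g-images of the pairs of f, then the pairs of g *)
Definition wcomp (X Y U V Z W : finType) (g : wdiag U V Z W) (f : wdiag X Y U V) :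
    wdiag X Y Z W :=
  exist (@wdiag_ok X Y Z W) _ (wcomp_subproof g f).

Lemma wcomp1l (X Y U V : finType) (f : wdiag X Y U V) : wcomp (wid U V) f = f.
Proof.
apply: wdiag_eq.
- by apply/ffunP => x; rewrite ffunE [winl (wid _ _) _]ffunE.
- by apply/ffunP => x; rewrite ffunE [winr (wid _ _) _]ffunE.
rewrite [LHS]cats0 -[RHS]map_id; apply: eq_map => -[u v] /=.
by rewrite [winl (wid _ _) _]ffunE [winr (wid _ _) _]ffunE.
Qed.

Lemma wcomp1r (X Y U V : finType) (f : wdiag X Y U V) : wcomp f (wid X Y) = f.
Proof.
apply: wdiag_eq => //.
- by apply/ffunP => x; rewrite ffunE [winl (wid _ _) _]ffunE.
- by apply/ffunP => x; rewrite ffunE [winr (wid _ _) _]ffunE.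
Qed.

Lemma wcompA (X Y U V Z W P Q : finType) (h : wdiag Z W P Q) (g : wdiag U V Z W)
    (f : wdiag X Y U V) :
  wcomp h (wcomp g f) = wcomp (wcomp h g) f.
Proof.
apply: wdiag_eq.
- by apply/ffunP => x; rewrite !ffunE.
- by apply/ffunP => x; rewrite !ffunE.
rewrite /wlst /= map_cat -map_comp -catA; congr (_ ++ _).
by apply: eq_map => -[u v] /=; rewrite /winl /winr /= !ffunE.
Qed.

Lemma wiota_half (X : finType) (s : X) :
  perm_eq (codom [ffun x : rem s => val x] ++ [:: s]) (enum X).
Proof.
apply: uniq_perm; last 2 first.
- exact: enum_uniq.
- move=> x; rewrite mem_cat inE mem_enum codom_ffun /=.
  case: (eqVneq x s) => [_|ne]; first by rewrite orbT.
  by rewrite orbF; apply/codomP; exists (rem_elt ne).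
rewrite cat_uniq /= orbF andbT codom_ffun; apply/andP; split.
  by rewrite /image_mem map_inj_uniq ?enum_uniq //; exact: val_inj.
by apply/codomP => -[x e]; have := valP x; rewrite /= -[sval x]e eqxx.
Qed.

Lemma wiota_subproof (X Y : finType) (s : X) (t : Y) :
  wdiag_ok ([ffun x : rem s => val x], [ffun y : rem t => val y], [:: (s, t)]).
Proof. by rewrite /wdiag_ok /= !wiota_half. Qed.

Definition wiota (X Y : finType) (s : X) (t : Y) : wdiag (rem s) (rem t) X Y :=
  exist (@wdiag_ok (rem s) (rem t) X Y) _ (wiota_subproof s t).

(* reorderings of lists, with their parity *)
Definition reorder (T : Type) (b : bool) (l l' : seq T) : Prop :=
  exists n (t : n.-tuple T) (s : 'S_n),
    [/\ l = t, l' = [tuple tnth t (s i) | i < n] & b = s].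

Lemma reorder_cons (T : Type) b (x : T) l l' :
  reorder b l l' -> reorder b (x :: l) (x :: l').
Proof.
case=> n [t [s [-> -> ->]]].
exists n.+1, [tuple of x :: t], (lift_perm ord0 ord0 s); split => //.
  apply: (@eq_from_nth _ x) => [|j hj]; first by rewrite [RHS]size_tuple /= size_map size_enum_ord.
  have {}hj : (j < n.+1)%N by move: hj; rewrite /= size_map size_enum_ord.
  rewrite -[RHS](tnth_nth _ _ (Ordinal hj)) tnth_mktuple.
  case: (unliftP ord0 (Ordinal hj)) => [j' e|e]; rewrite e; last first.
    have -> : j = 0%N by rewrite -[LHS]/(nat_of_ord (Ordinal hj)) e.
    by rewrite lift_perm_id (tnth_nth x).
  have -> : j = j'.+1 by rewrite -[LHS]/(nat_of_ord (Ordinal hj)) e lift0.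
  rewrite lift_perm_lift [RHS](tnth_nth x) lift0 /=.
  by rewrite -[LHS](tnth_nth x [tuple tnth t (s i) | i < n] j') tnth_mktuple (tnth_nth x).
by rewrite odd_lift_perm addbb addFb.
Qed.

Lemma reorder_rcons (T : Type) b (x : T) l l' :
  reorder b l l' -> reorder b (rcons l x) (rcons l' x).
Proof.
case=> n [t [s [-> -> ->]]].
exists n.+1, [tuple of rcons t x], (lift_perm ord_max ord_max s); split => //.
  apply: (@eq_from_nth _ x) => [|j hj]; first by rewrite [RHS]size_tuple size_rcons /= size_map size_enum_ord.
  have {}hj : (j < n.+1)%N by move: hj; rewrite size_rcons /= size_map size_enum_ord.
  rewrite -[RHS](tnth_nth _ _ (Ordinal hj)) tnth_mktuple.
  case: (unliftP ord_max (Ordinal hj)) => [j' e|e]; rewrite e; last first.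
    have -> : j = n by rewrite -[LHS]/(nat_of_ord (Ordinal hj)) e.
    rewrite lift_perm_id (tnth_nth x) /= !nth_rcons size_tuple size_map.
    by rewrite size_enum_ord ltnn eqxx.
  have -> : j = j' by rewrite -[LHS]/(nat_of_ord (Ordinal hj)) e lift_max.
  rewrite lift_perm_lift [RHS](tnth_nth x) lift_max /=.
  rewrite !nth_rcons size_tuple size_map size_enum_ord !ltn_ord.
  by rewrite -[LHS](tnth_nth x [tuple tnth t (s i) | i < n] j') tnth_mktuple (tnth_nth x).
by rewrite odd_lift_perm addbb addFb.
Qed.

Lemma reorder_catl (T : Type) b (l0 l l' : seq T) :
  reorder b l l' -> reorder b (l0 ++ l) (l0 ++ l').
Proof. by move=> h; elim: l0 => //= x l0; exact: reorder_cons. Qed.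

Lemma reorder_catr (T : Type) b (l0 l l' : seq T) :
  reorder b l l' -> reorder b (l ++ l0) (l' ++ l0).
Proof.
elim: l0 l l' => [|x l0 ih] l l'; first by rewrite !cats0.
by rewrite -!cat_rcons => h; apply: ih; exact: reorder_rcons.
Qed.

Lemma reorder_map (T T' : Type) (h : T -> T') b l l' :
  reorder b l l' -> reorder b (map h l) (map h l').
Proof.
case=> n [t [s [-> -> ->]]]; exists n, (map_tuple h t), s; split => //.
by rewrite /= -map_comp; apply: eq_map => i /=; rewrite tnth_map.
Qed.
End DiagramOps.

Section WalledBrauer.
Variables (k : fieldType) (d : sign).

(* reordering the n pairs by s in S_n multiplies by the character of s *)
Definition wrel (X Y U V : finType) (u : free (k := k) (wdiag X Y U V)) : Prop :=
  exists (w w' : wdiag X Y U V) n (t : n.-tuple (U * V)) (s : 'S_n),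
    [/\ winl w = winl w', winr w = winr w', wlst w = t,
        wlst w' = [tuple tnth t (s i) | i < n]
      & u = gen w' - sgn k d s *: gen w].

Definition uhom (X Y U V : finType) : lmodType k := lquot (@wrel X Y U V).

Definition wcls (X Y U V : finType) (w : wdiag X Y U V) : uhom X Y U V :=
  qpi (@wrel X Y U V) (gen w).

Lemma wcls_reorder (X Y U V : finType) (w w' : wdiag X Y U V) n (s : 'S_n) :
  winl w = winl w' -> winr w = winr w' -> reorder s (wlst w) (wlst w') ->
  wcls w' = sgn k d s *: wcls w.
Proof.
move=> e1 e2 [m [t [s' [e3 e4 e5]]]].
have -> : sgn k d s = sgn k d s' by rewrite /sgn e5.
rewrite /wcls -(linZ (@qpi_lin _ _ _)); apply/qpiP; apply: span_sub.
by exists w, w', m, t, s'.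
Qed.

Lemma uhom_ext (X Y U V : finType) (W : lmodType k) (f g : uhom X Y U V -> W) :
  linear f -> linear g -> (forall w, f (wcls w) = g (wcls w)) -> f =1 g.
Proof.
move=> hf hg e; apply: lquot_ext; apply: free_ext => //.
- by move=> a u v; rewrite qpi_lin hf.
- by move=> a u v; rewrite qpi_lin hg.
Qed.

Section Lift.
Context {X Y U V : finType} {W : lmodType k}.
Variable h : wdiag X Y U V -> W.
Hypothesis h_reorder : forall w w' n (s : 'S_n),
  winl w = winl w' -> winr w = winr w' -> reorder s (wlst w) (wlst w') ->
  h w' = sgn k d s *: h w.

Lemma uhom_lift_rel u : wrel u -> flift h u = 0.
Proof.
case=> w [w' [n [t [s [e1 e2 e3 e4 ->]]]]].
rewrite (linB (@flift_lin _ _ _ h)) (linZ (@flift_lin _ _ _ h)) !flift_gen.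
by rewrite (@h_reorder w w' n s) ?subrr //; exists n, t, s.
Qed.

Lemma uhom_lift_lin : linear (qlift (S := @wrel X Y U V) (flift h)).
Proof. by apply: qlift_lin; [exact: flift_lin|exact: uhom_lift_rel]. Qed.

Lemma uhom_lift_cls w : qlift (S := @wrel X Y U V) (flift h) (wcls w) = h w.
Proof.
rewrite /wcls qlift_pi ?flift_gen //; [exact: flift_lin|exact: uhom_lift_rel].
Qed.
End Lift.

Section Comp.
Context {X Y U V Z W : finType}.

Definition ucomp (g : uhom U V Z W) (f : uhom X Y U V) : uhom X Y Z W :=
  qlift (flift (fun wf => qlift (flift (fun wg => wcls (wcomp wg wf))) g)) f.

Lemma ucomp_reorderl (wf : wdiag X Y U V) (w w' : wdiag U V Z W) n (s : 'S_n) :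
  winl w = winl w' -> winr w = winr w' -> reorder s (wlst w) (wlst w') ->
  wcls (wcomp w' wf) = sgn k d s *: wcls (wcomp w wf).
Proof.
move=> e1 e2 h; apply: wcls_reorder.
- by apply/ffunP => x; rewrite !ffunE e1.
- by apply/ffunP => x; rewrite !ffunE e2.
by rewrite /wlst /= -e1 -e2; exact: reorder_catl.
Qed.

Lemma ucomp_reorderr (g : uhom U V Z W) (w w' : wdiag X Y U V) n (s : 'S_n) :
  winl w = winl w' -> winr w = winr w' -> reorder s (wlst w) (wlst w') ->
  qlift (flift (fun wg => wcls (wcomp wg w'))) g =
  sgn k d s *: qlift (flift (fun wg : wdiag U V Z W => wcls (wcomp wg w))) g.
Proof.
move=> e1 e2 h; move: g; apply: uhom_ext.
- by apply: uhom_lift_lin; exact: ucomp_reorderl.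
- move=> a u v; rewrite (uhom_lift_lin (@ucomp_reorderl w)).
  by rewrite scalerDr !scalerA mulrC.
move=> wg; rewrite !uhom_lift_cls; try exact: ucomp_reorderl.
apply: wcls_reorder.
- by apply/ffunP => x; rewrite !ffunE e1.
- by apply/ffunP => x; rewrite !ffunE e2.
by rewrite /wlst /=; apply: reorder_catr; exact: reorder_map.
Qed.

Lemma ucomp_cls wg wf : ucomp (wcls wg) (wcls wf) = wcls (wcomp wg wf).
Proof.
by rewrite /ucomp !uhom_lift_cls; [|exact: ucomp_reorderl|exact: ucomp_reorderr].
Qed.

Lemma ucomp_linr g : linear (ucomp g).
Proof. by apply: uhom_lift_lin; exact: ucomp_reorderr. Qed.

Lemma ucomp_linl f : linear (fun g => ucomp g f).
Proof.
move=> a u v; move: f; apply: uhom_ext.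
- exact: ucomp_linr.
- move=> b x y; rewrite !ucomp_linr !scalerDr !scalerA mulrC -!addrA.
  by congr (_ + _); rewrite addrCA.
move=> w; rewrite /ucomp !uhom_lift_cls; try exact: ucomp_reorderr.
by rewrite (uhom_lift_lin (@ucomp_reorderl w)).
Qed.
End Comp.

Lemma ucomp1l (X Y U V : finType) (f : uhom X Y U V) : ucomp (wcls (wid U V)) f = f.
Proof.
move: f; apply: uhom_ext; [exact: ucomp_linr|exact: lin_id|move=> w].
by rewrite ucomp_cls wcomp1l.
Qed.

Lemma ucomp1r (X Y U V : finType) (f : uhom X Y U V) : ucomp f (wcls (wid X Y)) = f.
Proof.
move: f; apply: uhom_ext; [exact: ucomp_linl|exact: lin_id|move=> w].
by rewrite ucomp_cls wcomp1r.
Qed.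

Lemma ucompA (X Y U V Z W P Q : finType) (h : uhom Z W P Q) (g : uhom U V Z W)
    (f : uhom X Y U V) :
  ucomp h (ucomp g f) = ucomp (ucomp h g) f.
Proof.
move: f; apply: uhom_ext => [||wf].
- exact: (lin_comp (ucomp_linr h) (ucomp_linr g)).
- exact: ucomp_linr.
move: g; apply: uhom_ext => [||wg].
- exact: (lin_comp (ucomp_linr h) (ucomp_linl (wcls wf))).
- exact: (lin_comp (ucomp_linl (wcls wf)) (ucomp_linr h)).
move: h; apply: uhom_ext => [||wh].
- exact: ucomp_linl.
- exact: (lin_comp (ucomp_linl (wcls wf)) (ucomp_linl (wcls wg))).
by rewrite !ucomp_cls wcompA.
Qed.

Definition uwb : lincat k :=
  {| lob := (finType * finType)%type;
     lhom := fun x y => uhom x.1 x.2 y.1 y.2;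
     lid := fun x => wcls (wid x.1 x.2);
     lcomp := fun x y z g f => ucomp g f;
     lcomp_linl := fun x y z f => ucomp_linl f;
     lcomp_linr := fun x y z g => ucomp_linr g;
     lcomp1l := fun x y f => ucomp1l f;
     lcomp1r := fun x y f => ucomp1r f;
     lcompA := fun x y z w h g f => ucompA h g f |}.

Definition dwb : lincat k := opcat uwb.

(* a dwb-module structure with underlying FB x FB-module M; a bijection
   (X, Y) -> (X', Y') is a morphism (X', Y') -> (X, Y) of dwb, acting on M
   by the inverse bijection *)
Record dwb_structure (M : FBmod k) := {
  dwb_mod :> linmod_on (C := dwb) (fun x => M x.1 x.2);
  dwb_bij : forall (X Y X' Y' : finType) (al : bij X X') (be : bij Y Y') (v : M X' Y'),
    lact (x := (X', Y') : dwb) (y := (X, Y) : dwb) dwb_mod (wcls (wbij al be)) v =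
    fbact (bij_sym al) (bij_sym be) v }.

Definition dwb_linmod (M : FBmod k) (m : dwb_structure M) : linmod dwb :=
  LinMod (dwb_mod m).

Definition contr (M : FBmod k) (m : dwb_structure M) (X Y : finType) (s : X) (t : Y) :
    M X Y -> M (rem s) (rem t) :=
  lact (x := (X, Y) : dwb) (y := (rem s : finType, rem t : finType) : dwb)
       m (wcls (wiota s t)).
End WalledBrauer.

(* labellings of (U \ {s}) + V and U + (V \ {t}) induced by labellings of U, V *)
Definition labl (U V : finType) (A : Type) (s : U) (u : U -> A) (v : V -> A)
    (x : rem s + V) : A :=
  match x with inl x => u (val x) | inr y => v y end.

Definition labr (U V : finType) (A : Type) (t : V) (u : U -> A) (v : V -> A)
    (x : U + rem t) : A :=
  match x with inl x => u x | inr y => v (val y) end.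

Section Labels.
Variables (A B C : Type).
Definition in1 (x : A) : A + B + C := inl (inl x).
Definition in2 (x : B) : A + B + C := inl (inr x).
Definition in3 (x : C) : A + B + C := inr x.
End Labels.
Arguments in1 {A B C}.
Arguments in2 {A B C}.
Arguments in3 {A B C}.

Section Dioperads.
Variable k : fieldType.

(* x in M(P, Q) and x' in M(P', Q') agree under the bijections P -> P', Q -> Q'
   preserving the labels u, v and u', v'; for injective labellings these are
   the only such bijections. *)
Definition same_relabelled (M : FBmod k) (P Q P' Q' : finType) (A B : Type)
    (x : M P Q) (u : P -> A) (v : Q -> B) (x' : M P' Q') (u' : P' -> A) (v' : Q' -> B) :=
  exists (th1 : bij P P') (th2 : bij Q Q'),
    [/\ forall p, u' (th1 p) = u p, forall q, v' (th2 q) = v q & fbact th1 th2 x = x'].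

(* The associativity axioms: a, b, c have labels (U1, U2), (V1, V2), (W1, W2),
   p = (s, t) links a and b, q = (s', t') links b and c, p and q are disjoint.
   The axioms say that mu_q (mu_p (a (x) b) (x) c) and mu_p (a (x) mu_q (b (x) c))
   agree when their labels are compared in U1 + V1 + W1 and U2 + V2 + W2.
   There is one axiom for each
   orientation of p and q; when s is in V1, t in U2, s' in W1 and t' in V2, the
   axiom is dio_assoc with (a, p) and (c, q) exchanged. *)
Record dioperad := {
  dio :> FBmod k;
  dio0 : forall a : dio void void, a = 0;
  mu : forall (U1 U2 V1 V2 : finType) (s : U1) (t : V2),
    dio U1 U2 -> dio V1 V2 -> dio (rem s + V1)%type (U2 + rem t)%type;
  mu_linl : forall (U1 U2 V1 V2 : finType) (s : U1) (t : V2) (b : dio V1 V2),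
    linear (fun a : dio U1 U2 => mu s t a b);
  mu_linr : forall (U1 U2 V1 V2 : finType) (s : U1) (t : V2) (a : dio U1 U2),
    linear (fun b : dio V1 V2 => mu s t a b);
  mu_nat : forall (U1 U2 V1 V2 U1' U2' V1' V2' : finType)
    (al1 : bij U1 U1') (al2 : bij U2 U2') (be1 : bij V1 V1') (be2 : bij V2 V2')
    (s : U1) (t : V2) (a : dio U1 U2) (b : dio V1 V2),
    mu (al1 s) (be2 t) (fbact al1 al2 a) (fbact be1 be2 b) =
    fbact (bij_sum (bij_rem al1 s) be1) (bij_sum al2 (bij_rem be2 t)) (mu s t a b);
  (* s in U1, t in V2; s' in V1, t' in W2 *)
  dio_assoc : forall (U1 U2 V1 V2 W1 W2 : finType)
    (a : dio U1 U2) (b : dio V1 V2) (c : dio W1 W2)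
    (s : U1) (t : V2) (s' : V1) (t' : W2),
    same_relabelled
      (mu (inr s' : rem s + V1)%type t' (mu s t a b) c)
      (labl (labl in1 in2) in3) (labr (labr in1 in2) in3)
      (mu s (inl t : V2 + rem t')%type a (mu s' t' b c))
      (labl in1 (labl in2 in3)) (labr in1 (labr in2 in3));
  (* s in U1, t in V2; s' in W1, t' in V2 *)
  dio_assoc_out : forall (U1 U2 V1 V2 W1 W2 : finType)
    (a : dio U1 U2) (b : dio V1 V2) (c : dio W1 W2)
    (s : U1) (t : V2) (s' : W1) (t' : V2) (h : t != t') (h' : t' != t),
    same_relabelled
      (mu s' (inr (rem_elt h') : U2 + rem t)%type c (mu s t a b))
      (labl in3 (labl in1 in2)) (labr in3 (labr in1 in2))
      (mu s (inr (rem_elt h) : W2 + rem t')%type a (mu s' t' c b))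
      (labl in1 (labl in3 in2)) (labr in1 (labr in3 in2));
  (* s in V1, t in U2; s' in V1, t' in W2 *)
  dio_assoc_in : forall (U1 U2 V1 V2 W1 W2 : finType)
    (a : dio U1 U2) (b : dio V1 V2) (c : dio W1 W2)
    (s : V1) (t : U2) (s' : V1) (t' : W2) (h : s != s') (h' : s' != s),
    same_relabelled
      (mu (inl (rem_elt h') : rem s + U1)%type t' (mu s t b a) c)
      (labl (labl in2 in1) in3) (labr (labr in2 in1) in3)
      (mu (inl (rem_elt h) : rem s' + W1)%type t (mu s' t' b c) a)
      (labl (labl in2 in3) in1) (labr (labr in2 in3) in1) }.

Record diop_hom (D E : dioperad) := {
  dhom :> FBhom D E;
  dhom_mu : forall (U1 U2 V1 V2 : finType) (s : U1) (t : V2)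
    (a : D U1 U2) (b : D V1 V2),
    dhom _ _ (mu s t a b) = mu s t (dhom _ _ a) (dhom _ _ b) }.

Lemma diop_hom_eq (D E : dioperad) (f g : diop_hom D E) :
  (forall (X Y : finType) (x : D X Y), f X Y x = g X Y x) -> f = g.
Proof.
case: f g => [f fm] [g gm] /= /FBhom_eq e.
by subst g; congr Build_diop_hom; apply: Prop_irrelevance.
Qed.

Definition diop_id (D : dioperad) : diop_hom D D :=
  @Build_diop_hom D D (FBhom_id D) (fun U1 U2 V1 V2 s t a b => erefl).

Lemma diop_comp_subproof (D E F : dioperad) (g : diop_hom E F) (f : diop_hom D E)
    (U1 U2 V1 V2 : finType) (s : U1) (t : V2) (a : D U1 U2) (b : D V1 V2) :
  FBhom_comp g f _ _ (mu s t a b) =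
    mu s t (FBhom_comp g f _ _ a) (FBhom_comp g f _ _ b).
Proof. by rewrite /= !dhom_mu. Qed.

Definition diop_comp (D E F : dioperad) (g : diop_hom E F) (f : diop_hom D E) :
    diop_hom D F :=
  @Build_diop_hom D F (FBhom_comp g f) (diop_comp_subproof g f).

Program Definition Diop : category :=
  {| cob := dioperad; chom := diop_hom; catid := diop_id; catcomp := diop_comp |}.
Next Obligation. by apply: diop_hom_eq. Qed.
Next Obligation. by apply: diop_hom_eq. Qed.
Next Obligation. by apply: diop_hom_eq. Qed.
End Dioperads.

Definition lst1 (r : nat) : 'I_r.+2 := widen_ord (leqnSn r.+1) ord_max.
Definition lst2 (r : nat) : 'I_r.+2 := ord_max.

Section MergeLabels.
Context {X : finType} {r : nat}.
Variables (f : {ffun X -> 'I_r.+2}) (s : X).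

Definition merge_dec : {ffun rem s -> 'I_r.+1} := [ffun x => inord (minn (f (val x)) r)].

Lemma merge_decE (x : rem s) (i : 'I_r.+1) :
  (merge_dec x == i) = (minn (f (val x)) r == i).
Proof.
by rewrite ffunE -val_eqE /= inordK // ltnS geq_minr.
Qed.

Section Old.
Variable i : 'I_r.+1.
Hypothesis i_old : i != ord_max.
Hypothesis s_last : (r <= f s)%N.
Local Notation i' := (widen_ord (leqnSn r.+1) i).

Lemma old_lt : (i < r)%N.
Proof. by move: i_old; rewrite -val_eqE /= ltn_neqAle -ltnS ltn_ord andbT. Qed.

Lemma merge_old_subproof (p : fib f i') :
  exists q : fib merge_dec i, val (val q) = val p.
Proof.
have fp : f (val p) = i :> nat by rewrite (eqP (valP p)).
have hs : val p != s.
  by apply: contraTneq s_last => <-; rewrite fp -ltnNge old_lt.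
have hf : merge_dec (rem_elt hs) == i.
  by rewrite merge_decE /= fp (minn_idPl _) // ltnW // old_lt.
by exists (fib_elt hf).
Qed.

Lemma merge_old_subproof' (q : fib merge_dec i) :
  exists p : fib f i', val p = val (val q).
Proof.
have hf : f (val (val q)) == i'.
  have := valP q; rewrite merge_decE /minn -val_eqE /=.
  by case: ifP => // _ /eqP e; have := old_lt; rewrite -e ltnn.
by exists (fib_elt hf).
Qed.

Definition merge_old : bij (fib f i') (fib merge_dec i) :=
  relabel (u := val) (v := val \o val) val_inj (inj_comp val_inj val_inj)
    merge_old_subproof merge_old_subproof'.
End Old.

Lemma merge_new_subproof (x : rem s) (i : 'I_r.+1) : i = ord_max ->
  (merge_dec x == i) = ((f (val x) == lst1 r) || (f (val x) == lst2 r)).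
Proof.
move=> ->; rewrite merge_decE -!val_eqE /=.
have := ltn_ord (f (val x)); rewrite ltnS leq_eqVlt ltnS.
case/orP => [/eqP ->|h]; first by rewrite eqxx orbT (minn_idPr _) ?eqxx.
by rewrite (minn_idPl h) (ltn_eqF (_ : f (val x) < r.+1)%N) ?orbF.
Qed.

(* the new factor: (X_i \ {s}) + X_j *)
Section NewL.
Variable i : 'I_r.+1.
Hypothesis i_new : i = ord_max.
Hypothesis fs : f s == lst1 r.
Local Notation s' := (fib_elt fs).

Definition newl_lab : rem s' + fib f (lst2 r) -> X := labl val val.

Lemma newl_lab_inj : injective newl_lab.
Proof.
have d (x : fib f (lst1 r)) (y : fib f (lst2 r)) : val x <> val y.
  move=> e; have := valP x; rewrite /= -[sval x]/(val x) e (eqP (valP y)).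
  by rewrite -val_eqE /= gtn_eqF.
case=> x [] y /= e.
- by congr inl; apply: val_inj; apply: val_inj.
- by case: (d (val x) y).
- by case: (d (val y) x).
- by congr inr; apply: val_inj.
Qed.

Lemma merge_newl_subproof (p : rem s' + fib f (lst2 r)) :
  exists q : fib merge_dec i, val (val q) = newl_lab p.
Proof.
have hs : newl_lab p != s.
  case: p => [x|x] /=; first by have := valP x; rewrite -val_eqE.
  apply/eqP => e; have := valP x; rewrite /= e (eqP fs).
  by rewrite -val_eqE /= ltn_eqF.
have hf : merge_dec (rem_elt hs) == i.
  rewrite merge_new_subproof //=; case: (p) => [x|x] /=.
    by rewrite (eqP (valP (val x))) eqxx.
  by rewrite (eqP (valP x)) eqxx orbT.
by exists (fib_elt hf).
Qed.

Lemma merge_newl_subproof' (q : fib merge_dec i) :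
  exists p : rem s' + fib f (lst2 r), newl_lab p = val (val q).
Proof.
have := valP q; rewrite merge_new_subproof // => /orP[h|h].
  have h' : fib_elt h != s' by rewrite -val_eqE; exact: (valP (val q)).
  by exists (inl (rem_elt h')).
by exists (inr (fib_elt h)).
Qed.

Definition merge_newl : bij (rem s' + fib f (lst2 r)) (fib merge_dec i) :=
  relabel newl_lab_inj (inj_comp val_inj val_inj)
    merge_newl_subproof merge_newl_subproof'.
End NewL.

(* the new factor: Y_i + (Y_j \ {t}) *)
Section NewR.
Variable i : 'I_r.+1.
Hypothesis i_new : i = ord_max.
Hypothesis fs : f s == lst2 r.
Local Notation s' := (fib_elt fs).

Definition newr_lab : fib f (lst1 r) + rem s' -> X := labr val val.

Lemma newr_lab_inj : injective newr_lab.
Proof.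
have d (x : fib f (lst1 r)) (y : fib f (lst2 r)) : val x <> val y.
  move=> e; have := valP x; rewrite /= -[sval x]/(val x) e (eqP (valP y)).
  by rewrite -val_eqE /= gtn_eqF.
case=> x [] y /= e.
- by congr inl; apply: val_inj.
- by case: (d x (val y)).
- by case: (d y (val x)).
- by congr inr; apply: val_inj; apply: val_inj.
Qed.

Lemma merge_newr_subproof (p : fib f (lst1 r) + rem s') :
  exists q : fib merge_dec i, val (val q) = newr_lab p.
Proof.
have hs : newr_lab p != s.
  case: p => [x|x] /=; last by have := valP x; rewrite -val_eqE.
  apply/eqP => e; have := valP x; rewrite /= e (eqP fs).
  by rewrite -val_eqE /= gtn_eqF.
have hf : merge_dec (rem_elt hs) == i.
  rewrite merge_new_subproof //=; case: (p) => [x|x] /=.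
    by rewrite (eqP (valP x)) eqxx.
  by rewrite (eqP (valP (val x))) eqxx orbT.
by exists (fib_elt hf).
Qed.

Lemma merge_newr_subproof' (q : fib merge_dec i) :
  exists p : fib f (lst1 r) + rem s', newr_lab p = val (val q).
Proof.
have := valP q; rewrite merge_new_subproof // => /orP[h|h].
  by exists (inl (fib_elt h)).
have h' : fib_elt h != s' by rewrite -val_eqE; exact: (valP (val q)).
by exists (inr (rem_elt h')).
Qed.

Definition merge_newr : bij (fib f (lst1 r) + rem s') (fib merge_dec i) :=
  relabel newr_lab_inj (inj_comp val_inj val_inj)
    merge_newr_subproof merge_newr_subproof'.
End NewR.
End MergeLabels.

Section Contraction.
Context {k : fieldType}.
Variable D : dioperad k.

Section Joined.
Context {r : nat} {X Y : finType}.
Variables (fg : decomp r.+2 X Y) (a : decor D fg) (s : X) (t : Y).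
Hypotheses (fs : fg.1 s == lst1 r) (gt : fg.2 t == lst2 r).

Definition join_decomp : decomp r.+1 (rem s) (rem t) :=
  (merge_dec fg.1 s, merge_dec fg.2 t).

Lemma join_fs : (r <= fg.1 s)%N. Proof. by rewrite (eqP fs). Qed.
Lemma join_gt : (r <= fg.2 t)%N. Proof. by rewrite (eqP gt) /= ltnW. Qed.

(* (a_1, ..., a_r, a_(r+1), a_(r+2))
     |-> (a_1, ..., a_r, mu_(s,t) (a_(r+1) (x) a_(r+2))) *)
Definition join_decor : decor D join_decomp := fun i =>
  match @eqP _ i ord_max with
  | ReflectT e =>
      fbact (merge_newl e fs) (merge_newr e gt)
        (mu (fib_elt fs) (fib_elt gt) (a (lst1 r)) (a (lst2 r)))
  | ReflectF ne =>
      fbact (merge_old (introN eqP ne) join_fs) (merge_old (introN eqP ne) join_gt)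
        (a (widen_ord (leqnSn r.+1) i))
  end.
End Joined.

(* The contractions on the symmetric (d = Plus) or exterior (d = Minus) algebra
   of D. In the second clause sg moves the factors containing s and t to the
   last two positions: a_1 ... a_(r+2) = sgn(sg) w a_i a_j, where w is the
   product of the other factors. *)
Definition contraction_law (d : sign) (m : dwb_structure d (powFB d D)) : Prop :=
  (forall r (X Y : finType) (fg : decomp r X Y) (a : decor D fg) (s : X) (t : Y),
     fg.1 s = fg.2 t -> contr m s t (cls d a) = 0) /\
  (forall r (X Y : finType) (fg : decomp r.+2 X Y) (a : decor D fg) (s : X) (t : Y)
     (sg : 'S_r.+2) (hs : (perm_decomp sg fg).1 s == lst1 r)
     (ht : (perm_decomp sg fg).2 t == lst2 r),
     contr m s t (cls d a) = sgn k d sg *: cls d (join_decor (perm_decor sg a) hs ht)).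
End Contraction.

(* Main.v *)
Require Import Defs.
From mathcomp Require Import all_boot all_order all_algebra all_fingroup.
From mathcomp Require Import boolp.
Import Defs.

(** The category of upward walled Brauer diagrams is generated by bijections and
    single walled pairs, because the last pair of a diagram splits off as the
    last morphism of a composite. A module over the opposite category is thus
    the same as an FB x FB-module with linear contractions that are natural for
    bijections and satisfy one relation: contracting two disjoint pairs p and q
    in the two possible orders gives the same result up to the character of the
    transposition, which is 1 or -1 according to the sign of the category
    ([contractions], [contr_structure]). The relation is what makes the iterated
    contraction along a list of pairs transform by the right character when the
    list is reordered, since adjacent swaps generate all reorderings
    ([wact_reorder]).

    On the symmetric or exterior powers of a dioperad, contracting a pair brings
    the factors carrying its two labels to the last two positions and merges
    them by the structure map. Two ways of doing this differ by a permutation of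
    the other factors, which acts on the result with the same sign, so the
    contraction is well defined on coinvariants ([join_indep], [contr_genE]).

    The contractions along p and q are compared on a monomial by viewing the
    pairs as oriented edges between its factors ([pow_contr_anticommute]). If an
    edge is a loop or the edges are parallel, some contraction meets two labels
    of the same factor, and both composites are zero. If the edges share exactly
    one factor, the two composites merge the same three factors in different
    ways, and these agree by the associativity axiom for the orientation at hand.
    If the edges are disjoint, the same two merged factors arise. In the exterior
    case the orders in which the factors are arranged give opposite signs each
    time. To compare factors indexed by different iterated complements, monomials
    are described by lists of elements labelled in the original sets
    ([represents]): such a list determines the monomial ([rep_eq]), and each
    operation acts on it in an evident way. The same description shows that the
    contractions commute with bijections and with morphisms of dioperads
    ([pow_contr_nat], [pow_contr_map]), which gives functoriality. *)

Set Implicit Arguments.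
Unset Strict Implicit.
Unset Printing Implicit Defensive.

Import GRing.Theory.
Local Open Scope ring_scope.

(** * Reorderings of lists and their signs *)

(** Removing a point and its image leaves a permutation of the rest; the
    lifting lemmas then give its sign. *)
Lemma perm_is_lift n (s : 'S_n.+1) i : exists s' : 'S_n, s = lift_perm i (s i) s'.
Proof.
have ne j : s i != s (lift i j) by rewrite (inj_eq perm_inj) neq_lift.
pose f j : 'I_n := sval (unlift_some (ne j)).
have fE j : lift (s i) (f j) = s (lift i j) by rewrite /f; case: unlift_some.
have f_inj : injective f.
  by move=> j j' /(congr1 (lift (s i))); rewrite !fE => /perm_inj /lift_inj.
exists (perm f_inj); apply/permP => j; case: (unliftP i j) => [j'|] ->.
  by rewrite lift_perm_lift permE fE.
by rewrite lift_perm_id.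
Qed.

(** Reorderings with their parity, generated by adjacent swaps so that a
    property of reorderings can be proved on a single swap. Unlike [reorder],
    which goes through tuples, the relation applies to lists over a type as
    large as that of the labelled elements below. *)
Inductive swaps (T : Type) : bool -> seq T -> seq T -> Prop :=
| swaps_refl l : swaps false l l
| swaps_adj l1 x y l2 : swaps true (l1 ++ x :: y :: l2) (l1 ++ y :: x :: l2)
| swaps_trans b b' l l' l'' :
    swaps b l l' -> swaps b' l' l'' -> swaps (b (+) b') l l''.

Lemma swaps_cons (T : Type) b (x : T) l l' : swaps b l l' -> swaps b (x :: l) (x :: l').
Proof.
elim=> [{}l|l1 y z l2|{}b b' {}l {}l' l'' _ h _ h'].
- exact: swaps_refl.
- by rewrite -!cat_cons; exact: swaps_adj.
- exact: swaps_trans h h'.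
Qed.

Lemma swaps_front (T : Type) (x : T) l1 l2 :
  swaps (odd (size l1)) (l1 ++ x :: l2) (x :: l1 ++ l2).
Proof.
elim: l1 => [|y l1 ih] /=; first exact: swaps_refl.
rewrite -addbT; apply: swaps_trans (swaps_cons y ih) _.
exact: (swaps_adj [::]).
Qed.

(** Induction on the length: moving the entry that must come first costs as
    many swaps as its position, and this is the parity that [odd_lift_perm]
    attributes to it. *)
Lemma reorder_swaps (T : Type) b (l l' : seq T) : reorder b l l' -> swaps b l l'.
Proof.
case=> n [t [s [-> -> ->]]] {b l l'}; elim: n t s => [|n ih] t s.
  have -> : [tuple tnth t (s i) | i < 0] = t by apply: eq_from_tnth => -[].
  have -> : s = 1%g by apply/permP => -[].
  by rewrite odd_perm1; exact: swaps_refl.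
have [s' Es] := perm_is_lift s ord0; set j := s ord0 in Es.
pose x := tnth t j; pose l1 := take j t; pose l2 := drop j.+1 t.
have sz1 : size l1 = j by rewrite size_takel // size_tuple ltnW.
have Et : t = l1 ++ x :: l2 :> seq T.
  by rewrite /x (tnth_nth (tnth t j)) -drop_nth ?size_tuple // cat_take_drop.
have szm : size (l1 ++ l2) == n.
  have := size_tuple t; rewrite Et !size_cat /= addnS => -[<-].
  by [].
pose m := Tuple szm.
have Em (i : 'I_n) : tnth t (lift j i) = tnth m i.
  rewrite !(tnth_nth x) /= Et !nth_cat sz1 /bump; case: (leqP j i) => h /=.
    by rewrite add1n !ifN -?leqNgt ?leqW // subSn.
  by rewrite add0n h.
have -> : s = odd (size l1) (+) s' :> bool by rewrite Es odd_lift_perm sz1.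
rewrite {1}Et; apply: swaps_trans (swaps_front _ _ _) _.
suff -> : [tuple tnth t (s i) | i < n.+1] = x :: [tuple tnth m (s' i) | i < n] :> seq T.
  exact/swaps_cons/(ih m).
rewrite /= enum_ordSl /= -/x -map_comp; congr cons; apply: eq_map => i /=.
by rewrite -Em {1}Es lift_perm_lift.
Qed.

Lemma swaps_catl (T : Type) b (l0 l l' : seq T) : swaps b l l' ->
    swaps b (l0 ++ l) (l0 ++ l').
Proof. by move=> h; elim: l0 => //= x l0; exact: swaps_cons. Qed.

Lemma swaps_map (T T' : Type) (f : T -> T') b l l' : swaps b l l' ->
    swaps b (map f l) (map f l').
Proof.
elim=> [{}l|l1 y z l2|{}b b' {}l {}l' l'' _ h _ h'].
- exact: swaps_refl.
- by rewrite !map_cat; exact: swaps_adj.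
- exact: swaps_trans h h'.
Qed.

Lemma swaps_perm (T : eqType) b (l l' : seq T) : swaps b l l' -> perm_eq l l'.
Proof.
elim=> // [l1 x y l2|_ _ l0 l1 l2 _ h _ h']; last exact: perm_trans h h'.
by rewrite perm_cat2l -!(cat1s _ (_ :: _)) -!(cat1s _ l2) perm_catCA.
Qed.

Lemma perm_swaps (T : eqType) (l l' : seq T) : perm_eq l l' -> exists b, swaps b l l'.
Proof.
move=> h; rewrite perm_sym in h.
have /tuple_permP[s e] : perm_eq l' (in_tuple l) by [].
by exists s; apply: reorder_swaps; exists (size l), (in_tuple l), s.
Qed.

Lemma swaps_back (T : Type) (l : seq T) (x : T) m :
  swaps (odd (size m)) (l ++ x :: m) (l ++ rcons m x).
Proof.
apply: swaps_catl; elim: m => [|y m ih] /=; first exact: swaps_refl.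
rewrite -addTb; apply: swaps_trans (swaps_cons y ih).
exact: (swaps_adj [::]).
Qed.

(** The value on permutations of parity [b] of the trivial or sign character.
    *)
Definition eps (k : fieldType) (d : sign) (b : bool) : k :=
  if d is Minus then (-1) ^+ b else 1.

Lemma eps_addb (k : fieldType) d b b' : eps k d (b (+) b') = eps k d b * eps k d b'.
Proof. by case: d => /=; rewrite ?mul1r ?signr_addb. Qed.

Lemma eps0 (k : fieldType) d : eps k d false = 1.
Proof. by case: d. Qed.

Lemma eps_sq (k : fieldType) d b : eps k d b * eps k d b = 1.
Proof. by rewrite -eps_addb addbb eps0. Qed.

(** * Walled Brauer diagrams as products of single pairs and bijections *)

(** Since the entries of an enumeration are distinct, those other than the
    last one avoid it, so they live in its complement. A diagram consists of
    two such halves. *)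
Lemma unbump_ffun (X U : finType) (i : {ffun X -> U}) (m : seq U) (s : U) :
  perm_eq (codom i ++ rcons m s) (enum U) ->
  exists (i' : {ffun X -> rem s}) (m' : seq (rem s)),
    [/\ perm_eq (codom i' ++ m') (enum (rem s)),
        forall x, val (i' x) = i x & map val m' = m].
Proof.
move=> h; have u : uniq (codom i ++ rcons m s) by rewrite (perm_uniq h) enum_uniq.
have {}u : uniq (rcons (codom i ++ m) s) by rewrite rcons_cat.
move: u; rewrite rcons_uniq => /andP[sN u].
have hi x : i x != s.
  by apply: contraNneq sN => <-; rewrite mem_cat codom_f.
have hm y : y \in m -> y != s.
  by move=> ym; apply: contraNneq sN => <-; rewrite mem_cat ym orbT.
pose i' := [ffun x => rem_elt (hi x) : rem s].
pose m' : seq (rem s) := pmap insub m.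
have Em : map val m' = m.
  rewrite /m'; elim: (m) hm => //= y l ih hm.
  by rewrite insubT ?hm ?mem_head //= => yl; rewrite ih // => z zl;
    rewrite hm ?inE ?zl ?orbT.
have Ei : map val (codom i') = codom i.
  by rewrite /codom /image_mem -map_comp; apply: eq_map => x; rewrite /= ffunE.
exists i', m'; split => //; last by move=> x; rewrite ffunE.
apply: uniq_perm; last 2 first.
- exact: enum_uniq.
- move=> z; rewrite mem_enum -(mem_map val_inj) map_cat Ei Em.
  have : val z \in codom i ++ rcons m s by rewrite (perm_mem h) mem_enum.
  rewrite -rcons_cat mem_rcons inE => /orP[/eqP e|-> //].
  by have := valP z; rewrite /= -[sval z]/(val z) e eqxx.
by rewrite -(map_inj_uniq val_inj) map_cat Ei Em.
Qed.

Section Factor.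
Context {X Y U V : finType}.

Record factor (w : wdiag X Y U V) := Factor {
  fac_s : U;
  fac_t : V;
  fac_w : wdiag X Y (rem fac_s) (rem fac_t);
  facE : w = wcomp (wiota fac_s fac_t) fac_w }.

Lemma wlst_iota (s : U) (t : V) (w : wdiag X Y (rem s) (rem t)) :
  wlst (wcomp (wiota s t) w) = rcons [seq (val p.1, val p.2) | p <- wlst w] (s, t).
Proof.
rewrite /wlst /= cats1; congr rcons; apply: eq_map => p.
by rewrite /winl /winr /= !ffunE.
Qed.

Lemma winl_iota (s : U) (t : V) (w : wdiag X Y (rem s) (rem t)) x :
  winl (wcomp (wiota s t) w) x = val (winl w x).
Proof. by rewrite !ffunE. Qed.

Lemma winr_iota (s : U) (t : V) (w : wdiag X Y (rem s) (rem t)) y :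
  winr (wcomp (wiota s t) w) y = val (winr w y).
Proof. by rewrite !ffunE. Qed.

Lemma wiota_inj (s : U) (t : V) (w w' : wdiag X Y (rem s) (rem t)) :
  wcomp (wiota s t) w = wcomp (wiota s t) w' -> w = w'.
Proof.
move=> e; apply: wdiag_eq.
- by apply/ffunP => x; apply: val_inj; rewrite -!winl_iota e.
- by apply/ffunP => x; apply: val_inj; rewrite -!winr_iota e.
have := congr1 (@wlst X Y U V) e; rewrite !wlst_iota => /rcons_inj[].
by apply: inj_map => -[a b] [a' b'] /= [/val_inj -> /val_inj ->].
Qed.

(** The pair that can be split off is the last one of the list: composition
    appends the pairs of the outer diagram. *)
Lemma factor_rcons (w : wdiag X Y U V) l p : wlst w = rcons l p ->
  exists F : factor w, (fac_s F, fac_t F) = p.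
Proof.
case: p => s t e; case/andP: (valP w).
rewrite -/(winl w) -/(winr w) -[(sval w).2]/(wlst w) e /unzip1 /unzip2 !map_rcons /=.
case/unbump_ffun => i [m [hi iE mE]] /unbump_ffun[j [m' [hj jE m'E]]].
have sz : size m = size m' by rewrite -(size_map val m) mE size_map -(size_map snd) -m'E
  size_map.
have ok : wdiag_ok (i, j, zip m m').
  by rewrite /wdiag_ok /= unzip1_zip ?sz // unzip2_zip ?sz // hi hj.
pose w' : wdiag X Y (rem s) (rem t) := exist (@wdiag_ok X Y (rem s) (rem t)) _ ok.
have E : w = wcomp (wiota s t) w'.
  apply: wdiag_eq.
  - by apply/ffunP => x; rewrite winl_iota /= iE.
  - by apply/ffunP => x; rewrite winr_iota /= jE.
  rewrite wlst_iota e; congr rcons.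
  rewrite -[l]zip_unzip -[unzip1 l]mE -[unzip2 l]m'E [wlst w']/(zip m m').
  by elim: (m) (m') sz => [|a r ih] [|a' r'] //= [] /ih ->.
by exists (Factor E).
Qed.

(** The factorization is unique ([wfactor_iota]), so choosing one makes no
    difference. *)
Definition wfactor (w : wdiag X Y U V) : option (factor w) :=
  if pselect (exists F : factor w, True) is left H then Some (sval (cid H)) else None.

Lemma wfactor_iota (s : U) (t : V) (w : wdiag X Y (rem s) (rem t)) :
  wfactor (wcomp (wiota s t) w) = Some (Factor erefl).
Proof.
rewrite /wfactor; case: pselect => [H|[]]; last by exists (Factor erefl).
congr Some; case: (cid H) => /= -[s' t' w' e] _ {H}.
have : rcons [seq (val p.1, val p.2) | p <- wlst w] (s, t) =
       rcons [seq (val p.1, val p.2) | p <- wlst w'] (s', t').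
  by rewrite -!wlst_iota e.
move=> /rcons_inj[_ es et]; subst s' t'; have ew := wiota_inj e; subst w'.
by rewrite (Prop_irrelevance e erefl).
Qed.

Lemma codom_perm_bij (A B : finType) (i : {ffun A -> B}) :
  perm_eq (codom i) (enum B) -> bijective i.
Proof.
move=> h; have i_inj : injective i.
  by apply/injectiveP; rewrite /injectiveb /dinjectiveb (perm_uniq h) enum_uniq.
have isurj b : exists a, i a == b.
  have : b \in codom i by rewrite (perm_mem h) mem_enum.
  by case/codomP => a ->; exists a.
exists (fun b => xchoose (isurj b)) => [a|b]; last exact/eqP/(xchooseP (isurj b)).
by apply: i_inj; apply/eqP/(xchooseP (isurj (i a))).
Qed.

Lemma nil_wbij (w : wdiag X Y U V) : wlst w = [::] ->
  exists (al : bij X U) (be : bij Y V), w = wbij al be.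
Proof.
move=> e; case/andP: (valP w).
rewrite -/(winl w) -/(winr w) -[(sval w).2]/(wlst w) e /= !cats0.
move=> /codom_perm_bij[i' iK i'K] /codom_perm_bij[j' jK j'K].
exists (Bij iK i'K), (Bij jK j'K); apply: wdiag_eq => //.
- by apply/ffunP => x; rewrite [RHS]ffunE.
- by apply/ffunP => x; rewrite [RHS]ffunE.
Qed.
End Factor.

Lemma wbij_inj (X Y U V : finType) (al al' : bij X U) (be be' : bij Y V) :
  wbij al be = wbij al' be' -> al = al' /\ be = be'.
Proof.
move=> e; split; apply: bij_eq => x.
- by have := congr1 (fun w => winl w x) e; rewrite !ffunE.
- by have := congr1 (fun w => winr w x) e; rewrite !ffunE.
Qed.

(** Bijections and single pairs generate: a diagram without pairs is a
    bijection, and otherwise its last pair splits off. *)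
Lemma wdiag_ind (P : forall X Y U V : finType, wdiag X Y U V -> Prop) :
  (forall (X Y U V : finType) (al : bij X U) (be : bij Y V), P X Y U V (wbij al be)) ->
  (forall (X Y U V : finType) (s : U) (t : V) (w : wdiag X Y (rem s) (rem t)),
     P _ _ _ _ w -> P _ _ _ _ (wcomp (wiota s t) w)) ->
  forall X Y U V (w : wdiag X Y U V), P X Y U V w.
Proof.
move=> hb hi X Y U V w; move: {2}(size (wlst w)) (erefl (size (wlst w))) => n.
elim: n U V w => [|n ih] U V w.
  by move/eqP; rewrite size_eq0 => /eqP /nil_wbij[al [be ->]].
case/lastP e: (wlst w) => [//|l p]; rewrite size_rcons => -[sz].
have [[s t w' E] _] := factor_rcons e; subst w; apply/hi/ih.
have := congr1 size e; rewrite wlst_iota !size_rcons size_map sz => -[->].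
by [].
Qed.

Lemma wcomp_bij (X Y X' Y' X'' Y'' : finType) (al' : bij X' X'') (be' : bij Y' Y'')
    (al : bij X X') (be : bij Y Y') :
  wcomp (wbij al' be') (wbij al be) = wbij (bij_comp al' al) (bij_comp be' be).
Proof. by apply: wdiag_eq => //; apply/ffunP => x; rewrite /winl /winr /= !ffunE. Qed.

(** The exchange relation between the two kinds of generators; on modules it
    becomes the naturality of the contractions. *)
Lemma wcomp_bij_iota (U V U' V' : finType) (al : bij U U') (be : bij V V') s t :
  wcomp (wbij al be) (wiota s t) =
  wcomp (wiota (al s) (be t)) (wbij (bij_rem al s) (bij_rem be t)).
Proof.
apply: wdiag_eq.
- by apply/ffunP => x; rewrite /winl /= !ffunE.
- by apply/ffunP => x; rewrite /winr /= !ffunE.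
by rewrite /wlst /= /winl /winr /= !ffunE.
Qed.

(** * Modules presented by contractions *)

Section Presentation.
Variables (k : fieldType) (d : sign).

(** A presentation of modules by generators and relations. Besides naturality
    the only relation is that two disjoint pairs may be contracted in either
    order, up to the character of a transposition; [th1] and [th2] identify
    the two ways of removing two labels. *)
Record contractions (M : FBmod k) := {
  ctr :> forall (X Y : finType) (s : X) (t : Y), M X Y -> M (rem s) (rem t);
  ctr_lin : forall (X Y : finType) (s : X) (t : Y), linear (@ctr X Y s t);
  ctr_nat : forall (X Y X' Y' : finType) (al : bij X X') (be : bij Y Y')
      (s : X) (t : Y) (v : M X Y),
    ctr (al s) (be t) (fbact al be v) =
    fbact (bij_rem al s) (bij_rem be t) (ctr s t v);
  ctr_comm : forall (X Y : finType) (s s' : X) (t t' : Y)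
      (hs : s' != s) (hs' : s != s') (ht : t' != t) (ht' : t != t')
      (th1 : bij (rem (rem_elt hs)) (rem (rem_elt hs')))
      (th2 : bij (rem (rem_elt ht)) (rem (rem_elt ht'))) (v : M X Y),
    (forall p, val (val (th1 p)) = val (val p)) ->
    (forall q, val (val (th2 q)) = val (val q)) ->
    fbact th1 th2 (ctr (rem_elt hs) (rem_elt ht) (ctr s t v)) =
    eps k d true *: ctr (rem_elt hs') (rem_elt ht') (ctr s' t' v) }.

Section Action.
Variables (M : FBmod k) (c : contractions M).

Record bijfactor (X Y U V : finType) (w : wdiag X Y U V) := BijFactor {
  bf_al : bij X U; bf_be : bij Y V; bfE : w = wbij bf_al bf_be }.

(** A diagram without pairs determines its two bijections ([wbij_inj]), whose
    inverses act. *)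
Definition wact0 (X Y U V : finType) (w : wdiag X Y U V) (v : M U V) : M X Y :=
  if pselect (exists F : bijfactor w, True) is left H
  then let F := sval (cid H) in fbact (bij_sym (bf_al F)) (bij_sym (bf_be F)) v
  else 0.

(** The action is contravariant, so the pairs are contracted from the last one
    to the first, each time passing to the complement of the contracted
    labels; a bijection remains. The fuel [n] is the number of pairs. *)
Fixpoint wact_rec n (X Y U V : finType) (w : wdiag X Y U V) {struct n} :
    M U V -> M X Y :=
  if n is n'.+1 then
    if wfactor w is Some F then fun v => wact_rec n' (fac_w F) (ctr c (fac_s F) (fac_t F) v)
    else fun=> 0
  else wact0 w.

Definition wact (X Y U V : finType) (w : wdiag X Y U V) : M U V -> M X Y :=
  wact_rec (size (wlst w)) w.

Lemma wact_bij (X Y U V : finType) (al : bij X U) (be : bij Y V) v :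
  wact (wbij al be) v = fbact (bij_sym al) (bij_sym be) v.
Proof.
rewrite /wact /= /wact0; case: pselect => [H|[]]; last by exists (BijFactor erefl).
by case: (cid H) => -[al' be' e] /= _; case: (wbij_inj e) => -> ->.
Qed.

Lemma wact_iota (X Y U V : finType) (s : U) (t : V) (w : wdiag X Y (rem s) (rem t)) v :
  wact (wcomp (wiota s t) w) v = wact w (ctr c s t v).
Proof.
by rewrite /wact wlst_iota size_rcons size_map /= wfactor_iota.
Qed.

Lemma wact_lin (X Y U V : finType) (w : wdiag X Y U V) : linear (wact w).
Proof.
elim/wdiag_ind: X Y U V / w => [X Y U V al be|X Y U V s t w ih] a u v.
  by rewrite !wact_bij fbact_lin.
by rewrite !wact_iota ctr_lin ih.
Qed.

(** Naturality of the contractions pushes the bijection past one pair at a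
    time. *)
Lemma wact_bijl (X Y U V U' V' : finType) (w : wdiag X Y U V)
    (al : bij U U') (be : bij V V') v :
  wact (wcomp (wbij al be) w) v = wact w (fbact (bij_sym al) (bij_sym be) v).
Proof.
elim/wdiag_ind: X Y U V / w U' V' al be v => [X Y U V al' be'|X Y U V s t w ih] U' V' al be
  v.
  rewrite wcomp_bij !wact_bij -fbact_comp.
  exact: fbact_eq.
rewrite wcompA wcomp_bij_iota -wcompA !wact_iota ih; congr (wact w _).
have {1}-> : v = fbact al be (fbact (bij_sym al) (bij_sym be) v).
  rewrite -fbact_comp -[LHS]fbact_id; apply: fbact_eq => x; rewrite bij_compE /=;
    exact/esym/binvK.
rewrite ctr_nat -fbact_comp -[RHS]fbact_id.
by apply: fbact_eq => x; apply: bijK.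
Qed.

Lemma wact_comp (X Y U V Z W : finType) (g : wdiag U V Z W) (f : wdiag X Y U V) v :
  wact (wcomp g f) v = wact f (wact g v).
Proof.
elim/wdiag_ind: U V Z W / g f v => [U V Z W al be|U V Z W s t g ih] f v.
  by rewrite wact_bijl wact_bij.
by rewrite -wcompA !wact_iota ih.
Qed.

Lemma swap_rem (X : finType) (s s' : X) (hs : s' != s) (hs' : s != s') :
  exists th : bij (rem (rem_elt hs)) (rem (rem_elt hs')),
    forall p, val (val (th p)) = val (val p).
Proof.
pose lab (a : X) (b : rem a) (p : rem b) : X := val (val p).
have lab_inj a b : injective (@lab a b) by exact: inj_comp val_inj val_inj.
have ex (a b : X) (h : b != a) (h' : a != b) (p : rem (rem_elt h)) :
    exists q : rem (rem_elt h'), lab _ _ q = lab _ _ p.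
  have n1 : val (val p) != b by have := valP p; rewrite -val_eqE.
  have n2 : rem_elt n1 != rem_elt h' by rewrite -val_eqE; exact: valP (val p).
  by exists (rem_elt n2).
have lE := relabelE (lab_inj _ _) (lab_inj _ _) (ex _ _ hs hs') (ex _ _ hs' hs).
by exists (relabel (lab_inj _ _) (lab_inj _ _) (ex _ _ hs hs') (ex _ _ hs' hs)).
Qed.

Lemma map_adj_split (A B : Type) (f : A -> B) (L : seq A) l1 x y l2 :
  map f L = l1 ++ x :: y :: l2 ->
  exists l1' x' y' l2', [/\ L = l1' ++ x' :: y' :: l2', map f l1' = l1, f x' = x,
    f y' = y & map f l2' = l2].
Proof.
elim: l1 L => [|z l1 ih] [|a L] //=.
  by case: L => [|b L] //= [<- <- <-]; exists [::], a, b, L.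
case=> <- /ih[l1' [x' [y' [l2' [-> <- <- <- <-]]]]].
by exists (a :: l1'), x', y', l2'.
Qed.

(** When the swapped pairs are the last two of the list this is the relation
    [ctr_comm]: the two diagrams factor through the two ways of removing these
    pairs. In general the pairs after them are split off first. *)
Lemma wact_adj (X Y U V : finType) (w w' : wdiag X Y U V) l1 x y l2 v :
  winl w = winl w' -> winr w = winr w' ->
  wlst w = l1 ++ x :: y :: l2 -> wlst w' = l1 ++ y :: x :: l2 ->
  wact w' v = eps k d true *: wact w v.
Proof.
move: {2}(size l2) (erefl (size l2)) => n.
elim: n U V w w' l1 x y l2 v => [|n ih] U V w w' l1 x y l2 v.
  move=> /eqP; rewrite size_eq0 => /eqP -> {l2} e1 e2 e3 e4.
  have /factor_rcons[[s t w1 /= E] yE] : wlst w = rcons (rcons l1 x) y.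
    by rewrite e3 -!cats1 -catA.
  subst w y; move: e3; rewrite wlst_iota /= -cat_rcons cats1 => /rcons_inj[e3].
  case/lastP e5: (wlst w1) e3 => [|l1' x'].
    by move=> /(congr1 size); rewrite size_rcons.
  rewrite map_rcons => /rcons_inj[el1 ex].
  have [[a b w2 /= E] abE] := factor_rcons e5; subst w1 x'.
  case: a b w2 e1 e2 e5 ex => s' hs [t' ht] /= w2 e1 e2 e5 ex.
  have hs' : s != s' by rewrite eq_sym.
  have ht' : t != t' by rewrite eq_sym.
  have [th1 th1E] := swap_rem hs hs'; have [th2 th2E] := swap_rem ht ht'.
  have E : w' = wcomp (wiota s' t') (wcomp (wiota (rem_elt hs') (rem_elt ht'))
                  (wcomp (wbij th1 th2) w2)).
    apply: wdiag_eq.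
    - rewrite -e1; apply/ffunP => z; rewrite !winl_iota.
      by rewrite /winl /= !ffunE th1E.
    - rewrite -e2; apply/ffunP => z; rewrite !winr_iota.
      by rewrite /winr /= !ffunE th2E.
    rewrite e4 !wlst_iota map_rcons /= -cat_rcons cats1 -ex; congr (rcons (rcons _ _) _).
    move: e5; rewrite wlst_iota => /rcons_inj[el1'].
    rewrite -el1 -el1' -!map_comp /wlst /= cats0 -map_comp; apply: eq_map => p /=.
    by rewrite !ffunE th1E th2E.
  rewrite E !wact_iota wact_bijl -(linZ (wact_lin w2)); congr (wact w2 _).
  have /(congr1 (fun z => eps k d true *: z)) := ctr_comm c v th1E th2E.
  rewrite scalerA eps_sq scale1r => <-.
  rewrite (linZ (fbact_lin _ _)) -fbact_comp; congr (_ *: _).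
  by rewrite -[RHS]fbact_id; apply: fbact_eq => z; apply: bijK.
case/lastP: l2 => [//|l2 p]; rewrite size_rcons => -[sz] e1 e2.
rewrite -!rcons_cons -!rcons_cat => e3 e4.
have [[s t w1 /= E] pE] := factor_rcons e3.
have [[s' t' w1' /= E'] pE'] := factor_rcons e4.
move: pE; rewrite -{}pE' => -[es et]; subst s' t' w w'.
move: e3 e4; rewrite !wlst_iota => /rcons_inj[e3 _] /rcons_inj[e4 _].
have [l1' [x' [y' [l2' [e5 m1 mx my m2]]]]] := map_adj_split e3.
rewrite !wact_iota; apply: (ih _ _ w1 w1' l1' x' y' l2').
- by rewrite -sz -m2 size_map.
- by apply/ffunP => z; apply: val_inj; rewrite -!winl_iota e1.
- by apply/ffunP => z; apply: val_inj; rewrite -!winr_iota e2.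
- exact: e5.
move: e4; rewrite -m1 -mx -my -m2 -2!map_cons -map_cat.
by apply: inj_map => -[a b] [a' b'] /= [/val_inj -> /val_inj ->].
Qed.

(** Thus the action descends to the quotient defining the morphisms: adjacent
    swaps suffice, and every reordered list is the list of a diagram. *)
Lemma wact_reorder (X Y U V : finType) (w w' : wdiag X Y U V) b v :
  winl w = winl w' -> winr w = winr w' -> reorder b (wlst w) (wlst w') ->
  wact w' v = eps k d b *: wact w v.
Proof.
move=> e1 e2 /reorder_swaps h.
have [l el] : exists l, wlst w = l by exists (wlst w).
have [l' el'] : exists l', wlst w' = l' by exists (wlst w').
rewrite el el' in h.
elim: h w w' el el' e1 e2 => [{}l|l1 x y l2|{}b b' {}l m {}l' h ih h' ih'] w w' el el' e1
  e2.
- by rewrite eps0 scale1r; congr wact; apply: wdiag_eq; rewrite // el el'.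
- exact: (wact_adj (l1 := l1) (x := x) (y := y) (l2 := l2)).
have ok : wdiag_ok (winl w, winr w, m).
  case/andP: (valP w) => p1 p2; apply/andP; split => /=.
    apply: perm_trans p1; rewrite -/(winl w) perm_cat2l perm_map // perm_sym.
    by rewrite -[(sval w).2]/(wlst w) el; exact: swaps_perm h.
  apply: perm_trans p2; rewrite -/(winr w) perm_cat2l perm_map // perm_sym.
  by rewrite -[(sval w).2]/(wlst w) el; exact: swaps_perm h.
pose wm : wdiag X Y U V := exist (@wdiag_ok X Y U V) _ ok.
by rewrite (ih' wm w') // (ih w wm) // scalerA mulrC -eps_addb.
Qed.

Definition uact (X Y U V : finType) (f : uhom k d X Y U V) (v : M U V) : M X Y :=
  qlift (flift (fun w => wact w v)) f.

Lemma uact_reorder (X Y U V : finType) (v : M U V) (w w' : wdiag X Y U V) n (s : 'S_n) :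
  winl w = winl w' -> winr w = winr w' -> reorder s (wlst w) (wlst w') ->
  wact w' v = sgn k d s *: wact w v.
Proof. exact: wact_reorder. Qed.

Lemma uact_cls (X Y U V : finType) (w : wdiag X Y U V) v :
  uact (wcls k d w) v = wact w v.
Proof. by rewrite /uact uhom_lift_cls //; exact: uact_reorder. Qed.

Lemma uact_linl (X Y U V : finType) v : linear (fun f : uhom k d X Y U V => uact f v).
Proof. by apply: uhom_lift_lin; exact: uact_reorder. Qed.

Lemma uact_linr (X Y U V : finType) (f : uhom k d X Y U V) : linear (uact f).
Proof.
move=> a u v; move: f; apply: uhom_ext => [||w].
- exact: uact_linl.
- move=> b x y; rewrite !uact_linl !scalerDr !scalerA mulrC -!addrA.
  by congr (_ + _); rewrite addrCA.
by rewrite !uact_cls wact_lin.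
Qed.

Lemma uact_id (X Y : finType) v : uact (wcls k d (wid X Y)) v = v.
Proof. by rewrite uact_cls wact_bij -[RHS]fbact_id; apply: fbact_eq. Qed.

Lemma uact_comp (X Y U V Z W : finType) (g : uhom k d U V Z W) (f : uhom k d X Y U V) v :
  uact (ucomp g f) v = uact f (uact g v).
Proof.
move: f; apply: uhom_ext => [||f].
- exact: (lin_comp (uact_linl v) (ucomp_linr g)).
- exact: uact_linl.
move: g; apply: uhom_ext => [||g].
- exact: (lin_comp (uact_linl v) (ucomp_linl _)).
- exact: (lin_comp (uact_linr _) (uact_linl v)).
by rewrite ucomp_cls !uact_cls wact_comp.
Qed.

Definition contr_linmod : linmod_on (C := dwb k d) (fun x => M x.1 x.2) :=
  @Build_linmod_on k (dwb k d) (fun x => M x.1 x.2)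
    (fun x y f v => uact f v) (fun x y v => uact_linl v) (fun x y f => uact_linr f)
    (fun x v => uact_id v) (fun x y z g f v => uact_comp f g v).

Lemma contr_linmod_bij (X Y X' Y' : finType) (al : bij X X') (be : bij Y Y') (v : M X' Y') :
  lact (x := (X', Y') : dwb k d) (y := (X, Y) : dwb k d) contr_linmod
    (wcls k d (wbij al be)) v = fbact (bij_sym al) (bij_sym be) v.
Proof. by rewrite /= uact_cls wact_bij. Qed.

Definition contr_structure : dwb_structure d M :=
  {| dwb_mod := contr_linmod; dwb_bij := contr_linmod_bij |}.

Lemma contr_structureE (X Y : finType) (s : X) (t : Y) v :
  contr contr_structure s t v = ctr c s t v.
Proof.
rewrite /contr /= uact_cls -[wiota s t]wcomp1r wact_iota wact_bij -[RHS]fbact_id.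
exact: fbact_eq.
Qed.
End Action.

(** A map commuting with the generators commutes with all morphisms. *)
Lemma uact_nat (M N : FBmod k) (c : contractions M) (c' : contractions N) (h : FBhom M N) :
  (forall (X Y : finType) (s : X) (t : Y) v, h _ _ (ctr c s t v) = ctr c' s t (h _ _ v)) ->
  forall (X Y U V : finType) (f : uhom k d X Y U V) v,
    h _ _ (uact c f v) = uact c' f (h _ _ v).
Proof.
move=> hc X Y U V f v; move: f; apply: uhom_ext => [||w].
- exact: (lin_comp (@fbh_lin _ _ _ h X Y) (uact_linl c v)).
- exact: uact_linl.
rewrite !uact_cls; elim/wdiag_ind: X Y U V / w v => [X Y U V al be|X Y U V s t w ih] v.
  by rewrite !wact_bij fbh_nat.
by rewrite !wact_iota ih hc.
Qed.
End Presentation.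

(** * Monomials as lists of labelled elements *)

Section LabelledElements.
Context {k : fieldType}.

Lemma same_relabelled_map (M : FBmod k) (P Q P' Q' : finType) (A B A' B' : Type)
    (x : M P Q) (u : P -> A) (v : Q -> B) (x' : M P' Q') (u' : P' -> A) (v' : Q' -> B)
    (f : A -> A') (g : B -> B') (fu : P -> A') (gv : Q -> B') (fu' : P' ->
      A') (gv' : Q' -> B') :
  (forall p, fu p = f (u p)) -> (forall q, gv q = g (v q)) ->
  (forall p, fu' p = f (u' p)) -> (forall q, gv' q = g (v' q)) ->
  same_relabelled x u v x' u' v' -> same_relabelled x fu gv x' fu' gv'.
Proof.
move=> e1 e2 e3 e4 [th1 [th2 [h1 h2 h]]]; exists th1, th2; split => //.
- by move=> p; rewrite e1 e3 h1.
- by move=> p; rewrite e2 e4 h2.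
Qed.

Section Elements.
Context {M : FBmod k} {Z W : Type}.

(** An element of [M] together with labels in fixed sets [Z] and [W]. Iterated
    contractions change the index sets at each step; referring all labels to
    the original sets makes monomials over different index sets comparable. *)
Record labelled := Labelled {
  lp : finType; lq : finType; lu : lp -> Z; lv : lq -> W; lx : M lp lq }.

Definition same_labelled (e e' : labelled) :=
  same_relabelled (lx e) (@lu e) (@lv e) (lx e') (@lu e') (@lv e').

Lemma same_labelled_refl e : same_labelled e e.
Proof. by exists (bij_id _), (bij_id _); split => //; rewrite fbact_id. Qed.

Lemma same_labelled_sym e e' : same_labelled e e' -> same_labelled e' e.
Proof.
case=> th1 [th2 [h1 h2 h]]; exists (bij_sym th1), (bij_sym th2); split.
- by move=> p; rewrite -h1 /= binvK.
- by move=> p; rewrite -h2 /= binvK.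
rewrite -h -fbact_comp -[RHS]fbact_id; apply: fbact_eq => p; exact: bijK.
Qed.

Lemma same_labelled_trans e e' e'' : same_labelled e e' -> same_labelled e' e'' ->
    same_labelled e e''.
Proof.
case=> th1 [th2 [h1 h2 h]] [ph1 [ph2 [g1 g2 g]]].
exists (bij_comp ph1 th1), (bij_comp ph2 th2); split.
- by move=> p; rewrite bij_compE g1.
- by move=> p; rewrite bij_compE g2.
by rewrite fbact_comp h.
Qed.

Definition labelled0 : labelled :=
  @Labelled void void (of_void Z) (of_void W) 0.
End Elements.
Arguments labelled M Z W : clear implicits.

Section Factors.
Context {M : FBmod k} {X Y : finType} {Z W : Type}.
Variables (labX : X -> Z) (labY : Y -> W).

Definition labelled_factor r (fg : decomp r X Y) (a : decor M fg) (i : 'I_r) :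
    labelled M Z W :=
  Labelled (fun p : fib fg.1 i => labX (val p)) (fun q : fib fg.2 i => labY (val q)) (a i).

Lemma labelled_factor_perm r (s : 'S_r) (fg : decomp r X Y) (a : decor M fg) i :
  same_labelled (labelled_factor (perm_decor s a) i) (labelled_factor a ((s^-1)%g i)).
Proof.
apply: same_labelled_sym; exists (fib_bij (perm_dec_fib s fg.1 i)),
  (fib_bij (perm_dec_fib s fg.2 i)).
split => // p.
- by rewrite -[LHS]/(labX (val (fib_bij (perm_dec_fib s fg.1 i) p))) fib_bijE.
- by rewrite -[LHS]/(labY (val (fib_bij (perm_dec_fib s fg.2 i) p))) fib_bijE.
Qed.
End Factors.

Lemma labelled_factor_tr (M : FBmod k) (X Y X' Y' : finType) (Z W : Type)
    (labX : X -> Z) (labY : Y -> W)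
    (labX' : X' -> Z) (labY' : Y' -> W) (al : bij X X') (be : bij Y Y') r
    (fg : decomp r X Y) (a : decor M fg) i :
  (forall x, labX' (al x) = labX x) -> (forall y, labY' (be y) = labY y) ->
  same_labelled (labelled_factor labX' labY' (tr_decor al be a) i)
    (labelled_factor labX labY a i).
Proof.
move=> hX hY; apply: same_labelled_sym.
exists (fib_bij (tr_dec_fib al fg.1 i)), (fib_bij (tr_dec_fib be fg.2 i)); split => //.
- by move=> p; rewrite /= -[LHS]/(labX' (val (fib_bij _ p))) fib_bijE hX.
- by move=> p; rewrite /= -[LHS]/(labY' (val (fib_bij _ p))) fib_bijE hY.
Qed.

Section Represent.
Context {M : FBmod k} (d : sign) {X Y : finType} {Z W : Type}.
Variables (labX : X -> Z) (labY : Y -> W).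
Hypotheses (labX_inj : injective labX) (labY_inj : injective labY).

(** For injective labels, a label determines the factor that carries it, so
    the decompositions agree, and label-preserving bijections are unique, so
    the factors agree. *)
Lemma cls_same r (fg fg' : decomp r X Y) (a : decor M fg) (a' : decor M fg') :
  (forall i, same_labelled (labelled_factor labX labY a i)
    (labelled_factor labX labY a' i)) -> cls d a = cls d a'.
Proof.
move=> h; apply: cls_eq.
  have e1 x : fg'.1 x = fg.1 x.
    have [th1 [th2 [h1 _ _]]] := h (fg.1 x).
    have := h1 (fib_elt (eqxx (fg.1 x))) => /labX_inj /= e; rewrite -[x in LHS]e.
    exact: (eqP (valP (th1 _))).
  have e2 y : fg'.2 y = fg.2 y.
    have [th1 [th2 [_ h2 _]]] := h (fg.2 y).
    have := h2 (fib_elt (eqxx (fg.2 y))) => /labY_inj /= e; rewrite -[y in LHS]e.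
    exact: (eqP (valP (th2 _))).
  case: (fg) (fg') e1 e2 => [f g] [f' g'] /= e1 e2.
  by congr pair; apply/ffunP => x.
move=> i b1 b2 hb1 hb2; have [th1 [th2 [h1 h2 /= <-]]] := h i.
apply: fbact_eq => p; apply: val_inj.
- by rewrite hb1; apply: labX_inj; exact: (esym (h1 p)).
- by rewrite hb2; apply: labY_inj; exact: (esym (h2 p)).
Qed.

(** [v] is the monomial whose successive factors are the entries of [l], up to
    label-preserving bijections. The list determines [v] ([rep_eq]). *)
Definition represents (v : pow d M X Y) (l : seq (labelled M Z W)) : Prop :=
  exists r (fg : decomp r X Y) (a : decor M fg),
    [/\ v = cls d a, size l = r & forall i, same_labelled (labelled_factor labX labY a i)
      (nth labelled0 l i)].

Lemma rep_cls r (fg : decomp r X Y) (a : decor M fg) :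
  represents (cls d a) [seq labelled_factor labX labY a i | i <- enum 'I_r].
Proof.
exists r, fg, a; split => //; first by rewrite size_map size_enum_ord.
move=> i; rewrite (nth_map i) ?size_enum_ord // nth_ord_enum; exact: same_labelled_refl.
Qed.

Lemma rep_eq v v' l l' : represents v l -> represents v' l' -> size l = size l' ->
  (forall i, (i < size l)%N -> same_labelled (nth labelled0 l i) (nth labelled0 l' i)) ->
    v = v'.
Proof.
case=> r [fg [a [-> sz h]]] [r' [fg' [a' [-> sz' h']]]] e hl.
have er : r = r' by rewrite -sz -sz'.
move: fg' a' sz' h'; rewrite -er => fg' a' sz' h'; apply: cls_same => i.
apply: same_labelled_trans (h i) _; apply: same_labelled_trans (same_labelled_sym (h' i)).
by apply: hl; rewrite sz.
Qed.

Lemma rep_rcons_eq v v' l e e' :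
  represents v (rcons l e) -> represents v' (rcons l e') -> same_labelled e e' -> v = v'.
Proof.
move=> h h' ee; apply: (rep_eq h h'); rewrite !size_rcons // => i.
rewrite ltnS leq_eqVlt !nth_rcons => /orP[/eqP ->|->]; last exact: same_labelled_refl.
by rewrite ltnn eqxx.
Qed.

(** An adjacent swap of the list is a transposition of the factors, which the
    coinvariants turn into a sign. *)
Lemma rep_swaps v l l' b : swaps b l l' -> represents v l -> represents (eps k d b *: v) l'.
Proof.
move=> h; elim: h v => [{}l|l1 x y l2|{}b b' {}l {}l' l'' _ h _ h'] v hv.
- by rewrite eps0 scale1r.
- case: hv => r [fg [a [-> sz h]]].
  have szr : (size l1 + (size l2).+2)%N = r by rewrite -sz size_cat.
  have lt0 : (size l1 < r)%N by rewrite -szr -addSnnS leq_addr.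
  have lt1 : ((size l1).+1 < r)%N by rewrite -szr -2!addSnnS leq_addr.
  pose i0 := Ordinal lt0; pose i1 := Ordinal lt1.
  exists r, (perm_decomp (tperm i0 i1) fg), (perm_decor (tperm i0 i1) a); split.
  + rewrite cls_perm /sgn /eps odd_tperm; case: (d) => //.
    by rewrite -val_eqE /= eqn_leq ltnn andbF.
  + by rewrite -sz !size_cat.
  move=> i; apply: same_labelled_trans (labelled_factor_perm _ _ _ _ _) _; rewrite tpermV.
  apply: same_labelled_trans (h _) _.
  suff -> : nth labelled0 (l1 ++ x :: y :: l2) (tperm i0 i1 i) = nth labelled0
    (l1 ++ y :: x :: l2) i.
    exact: same_labelled_refl.
  case: tpermP => [->|->|n0 n1] /=; rewrite !nth_cat /= ?ltnn ?subnn ?ltnNge ?leqnSn //=.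
  + by rewrite subSnn.
  + by rewrite subSnn.
  case: leqP => // le1.
  have {n0}n0 : val i != size l1 by apply/eqP => e; case: n0; exact: val_inj.
  have {n1}n1 : val i != (size l1).+1 by apply/eqP => e; case: n1; exact: val_inj.
  have lt2 : ((size l1).+1 < i)%N by rewrite ltn_neqAle eq_sym n1 ltn_neqAle eq_sym n0.
  by rewrite -(subnSK (ltnW lt2)) -(subnSK lt2).
rewrite addbC eps_addb -scalerA; exact/h'/h.
Qed.

End Represent.

Lemma rep_act (M : FBmod k) d (X Y X' Y' : finType) (Z W : Type)
    (labX : X -> Z) (labY : Y -> W)
    (labX' : X' -> Z) (labY' : Y' -> W) (al : bij X X') (be : bij Y Y') (v :
      pow d M X Y) l :
  (forall x, labX' (al x) = labX x) -> (forall y, labY' (be y) = labY y) ->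
  represents labX labY v l -> represents labX' labY' (pow_act al be v) l.
Proof.
move=> hX hY [r [fg [a [-> sz h]]]].
exists r, (tr_decomp al be fg), (tr_decor al be a); split => //.
  by rewrite pow_act_cls.
by move=> i; apply: same_labelled_trans (h i); exact: labelled_factor_tr.
Qed.

Definition labelled_map (M N : FBmod k) (h : FBhom M N) (Z W : Type) (e :
    labelled M Z W) : labelled N Z W :=
  Labelled (@lu _ _ _ e) (@lv _ _ _ e) (h _ _ (lx e)).

Lemma rep_map (M N : FBmod k) (h : FBhom M N) d (X Y : finType) (Z W : Type)
    (labX : X -> Z) (labY : Y -> W) (v : pow d M X Y) l :
  represents labX labY v l -> represents labX labY (pow_map h v) (map (labelled_map h
    (Z := Z) (W := W)) l).
Proof.
case=> r [fg [a [-> sz H]]]; exists r, fg, (map_decor h a); split.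
- by rewrite pow_map_cls.
- by rewrite size_map.
move=> i; rewrite (nth_map labelled0) ?sz //.
have [th1 [th2 [h1 h2 e]]] := H i; exists th1, th2; split => //.
by rewrite /= -fbh_nat; congr (h _ _ _).
Qed.

(** Any chosen distinct factors can be moved to the end of a monomial; the
    sign stays unspecified because it cancels in every application. *)
Lemma select (T : Type) r (F : 'I_r -> T) (idx : seq 'I_r) : uniq idx ->
  exists l b, swaps b [seq F i | i <- enum 'I_r] (l ++ [seq F i | i <- idx]).
Proof.
move=> u; pose l := [seq i <- enum 'I_r | i \notin idx].
have /perm_swaps[b h] : perm_eq (enum 'I_r) (l ++ idx).
  apply: uniq_perm; first exact: enum_uniq.
    rewrite cat_uniq filter_uniq ?enum_uniq // u andbT /=; apply/hasPn => i ii.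
    by rewrite mem_filter ii.
  by move=> i; rewrite mem_cat /l [in RHS]mem_filter !mem_enum andbT orNb.
by exists (map F l), b; rewrite -map_cat; exact: swaps_map.
Qed.
End LabelledElements.
Arguments labelled {k} M Z W.

(** * Contractions on symmetric and exterior powers *)

Section Join.
Context {k : fieldType} {D : dioperad k} {Z W : Type}.

Definition labelled_mu (e1 e2 : labelled D Z W) (s : lp e1) (t : lq e2) : labelled D Z W :=
  Labelled (labl (s := s) (@lu _ _ _ _ e1) (@lu _ _ _ _ e2))
      (labr (t := t) (@lv _ _ _ _ e1) (@lv _ _ _ _ e2)) (mu s t (lx e1) (lx e2)).

Lemma labelled_mu_same (e1 e2 e1' e2' : labelled D Z W) (s : lp e1) (t : lq e2) (s' :
    lp e1') (t' : lq e2') :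
  injective (@lu _ _ _ _ e1') -> injective (@lv _ _ _ _ e2') ->
  same_labelled e1 e1' -> same_labelled e2 e2' -> lu s' = lu s -> lv t' = lv t ->
  same_labelled (labelled_mu s t) (labelled_mu s' t').
Proof.
move=> ui vi [al1 [al2 [h1 h2 h]]] [be1 [be2 [g1 g2 g]]] es et.
have {}es : s' = al1 s by apply: ui; rewrite h1.
have {}et : t' = be2 t by apply: vi; rewrite g2.
subst s' t'; exists (bij_sum (bij_rem al1 s) be1), (bij_sum al2 (bij_rem be2 t)); split.
- by case=> p /=; rewrite ?h1 ?g1.
- by case=> p /=; rewrite ?h2 ?g2.
by rewrite /= -mu_nat h g.
Qed.

Section Joined.
Context {r : nat} {X Y : finType}.
Variables (labX : X -> Z) (labY : Y -> W).
Variables (fg : decomp r.+2 X Y) (a : decor D fg) (s : X) (t : Y).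
Hypotheses (fs : fg.1 s == lst1 r) (gt : fg.2 t == lst2 r).

Let labX' (x : rem s) := labX (val x).
Let labY' (y : rem t) := labY (val y).

(** The factors of [join_decor] with the test [i = ord_max] abstracted, so
    that it can be analysed by cases. *)
Let join_fun i b (P : reflect (i = ord_max) b) :
    D (fib (merge_dec fg.1 s) i) (fib (merge_dec fg.2 t) i) :=
  match P with
  | ReflectT e =>
      fbact (merge_newl e fs) (merge_newr e gt)
        (mu (fib_elt fs) (fib_elt gt) (a (lst1 r)) (a (lst2 r)))
  | ReflectF ne =>
      fbact (merge_old (introN eqP ne) (join_fs fs)) (merge_old (introN eqP ne)
        (join_gt gt))
        (a (widen_ord (leqnSn r.+1) i))
  end.

Lemma join_decor_old i (ni : i != ord_max) :
  join_decor a fs gt i = fbact (merge_old ni (join_fs fs)) (merge_old ni (join_gt gt))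
                           (a (widen_ord (leqnSn r.+1) i)).
Proof.
rewrite -[LHS]/(join_fun (@eqP _ i ord_max)).
case: _ / (@eqP _ i ord_max) => [e|ne] /=; first by case/eqP: (ni).
by rewrite (Prop_irrelevance (introN eqP ne) ni).
Qed.

Lemma join_decor_new :
  join_decor a fs gt ord_max = fbact (merge_newl erefl fs) (merge_newr erefl gt)
    (mu (fib_elt fs) (fib_elt gt) (a (lst1 r)) (a (lst2 r))).
Proof.
rewrite -[LHS]/(join_fun (@eqP _ ord_max ord_max)).
case: _ / (@eqP _ ord_max ord_max) => [e|//] /=.
by rewrite (Prop_irrelevance e erefl).
Qed.

Lemma join_old i : i != ord_max ->
  same_labelled (labelled_factor labX' labY' (join_decor a fs gt) i)
        (labelled_factor labX labY a (widen_ord (leqnSn r.+1) i)).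
Proof.
move=> ni; apply: same_labelled_sym.
exists (merge_old ni (join_fs fs)), (merge_old ni (join_gt gt)); split.
- move=> p /=; rewrite /labX'; congr labX.
  by rewrite -[LHS]/((val \o val) (merge_old ni (join_fs fs) p)) relabelE.
- move=> p /=; rewrite /labY'; congr labY.
  by rewrite -[LHS]/((val \o val) (merge_old ni (join_gt gt) p)) relabelE.
by rewrite /= join_decor_old.
Qed.

Lemma join_new :
  same_labelled (labelled_factor labX' labY' (join_decor a fs gt) ord_max)
        (labelled_mu (e1 := labelled_factor labX labY a (lst1 r))
          (e2 := labelled_factor labX labY a (lst2 r))
             (fib_elt fs) (fib_elt gt)).
Proof.
apply: same_labelled_sym.
exists (merge_newl erefl fs), (merge_newr erefl gt); split.
- move=> p; rewrite /= /labX'.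
  rewrite -[X in labX X]/((val \o val) (merge_newl erefl fs p)) relabelE.
  by case: p.
- move=> p; rewrite /= /labY'.
  rewrite -[X in labY X]/((val \o val) (merge_newr erefl gt p)) relabelE.
  by case: p.
by rewrite /= join_decor_new.
Qed.
End Joined.
End Join.

Section Contraction.
Context {k : fieldType} (d : sign) (D : dioperad k).

Lemma lst21 r : lst2 r != lst1 r.
Proof. by rewrite -val_eqE /= gtn_eqF. Qed.

Lemma widen_old_neq r (i : 'I_r.+1) : i != ord_max ->
  lst1 r != widen_ord (leqnSn r.+1) i /\ lst2 r != widen_ord (leqnSn r.+1) i.
Proof.
move=> /old_lt h; split; rewrite -val_eqE /= gtn_eqF // ltnW.
Qed.

Lemma lst_or_old r (i : 'I_r.+2) :
  [\/ i = lst1 r, i = lst2 r |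
      exists2 j : 'I_r.+1, j != ord_max & i = widen_ord (leqnSn r.+1) j].
Proof.
case: (ltnP i r) => h.
  constructor 3; exists (Ordinal (ltnW h : (i < r.+1)%N)); last exact: val_inj.
  by rewrite -val_eqE /= neq_ltn h.
have := ltn_ord i; rewrite ltnS leq_eqVlt => /orP[/eqP e|h'].
  by constructor 2; apply: val_inj.
by constructor 1; apply: val_inj; apply/eqP; rewrite eqn_leq h andbT -ltnS.
Qed.

(** Changing one factor of a tuple changes exactly one factor of the joined
    tuple, and does so linearly: the last one if it is one of the two merged
    factors, by bilinearity of the structure map. *)
Lemma join_mlin r (X Y : finType) (fg : decomp r.+2 X Y) (s : X) (t : Y)
    (fs : fg.1 s == lst1 r) (gt : fg.2 t == lst2 r) :
  multilinear (fun a : decor D fg => cls d (join_decor a fs gt)).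
Proof.
move=> a i.
suff [j [phi phi_lin E]] : exists j, exists2 phi : D (fib fg.1 i) (fib fg.2 i) ->
    D (fib (merge_dec fg.1 s) j) (fib (merge_dec fg.2 t) j), linear phi &
    forall x, join_decor (dfwith a x) fs gt = dfwith (join_decor a fs gt) (phi x).
  by move=> c v w; rewrite !E phi_lin (@cls_mlin _ d D r.+1 _ _ (join_decomp fg s t)).
case: (lst_or_old i) => [->|->|[j nj ->]].
- exists ord_max, (fun x => fbact (merge_newl erefl fs) (merge_newr erefl gt)
    (mu (fib_elt fs) (fib_elt gt) x (a (lst2 r)))) => [c v w|x].
    by rewrite mu_linl fbact_lin.
  apply: functional_extensionality_dep => j.
  case: (eqVneq j ord_max) => [->|nj].
    by rewrite dfwith_in join_decor_new dfwith_in dfwith_out // eq_sym lst21.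
  have [n1 n2] := widen_old_neq nj.
  by rewrite dfwith_out 1?eq_sym // !join_decor_old dfwith_out.
- exists ord_max, (fun x => fbact (merge_newl erefl fs) (merge_newr erefl gt)
    (mu (fib_elt fs) (fib_elt gt) (a (lst1 r)) x)) => [c v w|x].
    by rewrite mu_linr fbact_lin.
  apply: functional_extensionality_dep => j.
  case: (eqVneq j ord_max) => [->|nj].
    by rewrite dfwith_in join_decor_new dfwith_in dfwith_out // lst21.
  have [n1 n2] := widen_old_neq nj.
  by rewrite dfwith_out 1?eq_sym // !join_decor_old dfwith_out.
have [n1 n2] := widen_old_neq nj.
exists j, (fun x => fbact (merge_old nj (join_fs fs)) (merge_old nj
  (join_gt gt)) x) => [|x].
  exact: fbact_lin.
apply: functional_extensionality_dep => j'.
case: (eqVneq j j') => [<-|nj'].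
  by rewrite dfwith_in join_decor_old dfwith_in.
rewrite [RHS]dfwith_out //; case: (eqVneq j' ord_max) => [->|nm].
  by rewrite !join_decor_new !dfwith_out // eq_sym.
by rewrite !join_decor_old dfwith_out //.
Qed.

(** Two orderings of a monomial whose last two factors carry [s] and [t]
    differ by a permutation fixing these two positions. It restricts to a
    permutation of the joined factors, fixing the merged one, with the same
    sign; hence the contraction does not depend on the ordering chosen. *)
Lemma join_indep r (X Y : finType) (fg fg' : decomp r.+2 X Y) (a : decor D fg) (a' :
    decor D fg')
    (s : X) (t : Y) (fs : fg.1 s == lst1 r) (gt : fg.2 t == lst2 r)
    (fs' : fg'.1 s == lst1 r) (gt' : fg'.2 t == lst2 r) (tau : 'S_r.+2) :
  (forall i, same_labelled (labelled_factor id id a' (tau i))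
    (labelled_factor id id a i)) ->
  cls d (join_decor a' fs' gt') = sgn k d tau *: cls d (join_decor a fs gt).
Proof.
move=> h.
have t1 : tau (lst1 r) = lst1 r.
  have [th1 [_ [h1 _ _]]] := h (lst1 r).
  have := valP (binv th1 (fib_elt fs)); have := h1 (binv th1 (fib_elt fs)).
  rewrite binvK /= => <- /eqP; rewrite (eqP fs'); exact: esym.
have t2 : tau (lst2 r) = lst2 r.
  have [_ [th2 [_ h2 _]]] := h (lst2 r).
  have := valP (binv th2 (fib_elt gt)); have := h2 (binv th2 (fib_elt gt)).
  rewrite binvK /= => <- /eqP; rewrite (eqP gt'); exact: esym.
have [tau' Etau] := perm_is_lift tau (lst2 r); rewrite t2 in Etau.
have liftE (i : 'I_r.+1) : lift (lst2 r) i = widen_ord (leqnSn r.+1) i.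
  by apply: val_inj; rewrite /= /bump leqNgt ltn_ord.
have tauE i : tau (widen_ord (leqnSn r.+1) i) = widen_ord (leqnSn r.+1) (tau' i).
  by rewrite -!liftE Etau lift_perm_lift.
have tm : tau' ord_max = ord_max.
  by apply: val_inj; rewrite -[LHS]/(val (widen_ord (leqnSn r.+1) (tau' ord_max))) -tauE t1.
have -> : sgn k d tau = sgn k d tau'.
  by rewrite /sgn Etau odd_lift_perm addbb.
rewrite -cls_perm; apply: (@cls_same _ _ d _ _ _ _ val val) => [||i].
- exact: val_inj.
- exact: val_inj.
rewrite -(permKV tau' i); move: ((tau'^-1)%g i) => {}i.
apply: same_labelled_trans; last exact/same_labelled_sym/labelled_factor_perm.
rewrite permK; case: (eqVneq i ord_max) => [->|ni].
  rewrite tm; apply: same_labelled_trans (join_new id id _ _ _) _.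
  apply: same_labelled_trans; last exact/same_labelled_sym/(join_new id id).
  apply: labelled_mu_same => //; try exact: val_inj.
  - by rewrite -{1}t1.
  - by rewrite -{1}t2.
apply: same_labelled_trans; last exact/same_labelled_sym/(join_old id id).
apply: same_labelled_trans (join_old id id _ _ _ _) _; last by rewrite -tauE.
by rewrite -tm (inj_eq perm_inj).
Qed.

Section Gen.
Context {X Y : finType}.
Variables (s : X) (t : Y).

Definition joinable r (fg : decomp r.+2 X Y) (sg : 'S_r.+2) :=
  (perm_decomp sg fg).1 s == lst1 r /\ (perm_decomp sg fg).2 t == lst2 r.

(** The contraction of a monomial: the factors of [s] and [t] are brought to
    the last two positions by some permutation and merged. When no permutation
    does this, both labels lie on one factor. *)
Definition contr_gen r : forall fg : decomp r X Y, decor D fg -> pow d D (rem s) (rem t) :=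
  match r with
  | r'.+2 => fun fg a =>
      if pselect (exists sg, joinable fg sg) is left H then
        let sg := sval (cid H) in
        sgn k d sg *: cls d (join_decor (perm_decor sg a)
          (proj1 (proj2_sig (cid H))) (proj2 (proj2_sig (cid H))))
      else 0
  | _ => fun _ _ => 0
  end.

Lemma contr_genE r (fg : decomp r.+2 X Y) (a : decor D fg) (sg : 'S_r.+2)
    (hs : (perm_decomp sg fg).1 s == lst1 r) (ht : (perm_decomp sg fg).2 t == lst2 r) :
  contr_gen a = sgn k d sg *: cls d (join_decor (perm_decor sg a) hs ht).
Proof.
rewrite /contr_gen; case: pselect => [H|[]]; last by exists sg.
case: (cid H) => sg' /= [hs' ht'].
rewrite (@join_indep _ _ _ _ _ (perm_decor sg a) (perm_decor sg' a) _ _ hs ht _ _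
  (sg^-1 * sg')%g).
  rewrite scalerA; congr (_ *: _).
  rewrite /sgn; case: (d); rewrite ?mulr1 // odd_permM odd_permV signr_addb.
  by rewrite mulrCA -signr_addb addbb mulr1.
move=> i; apply: same_labelled_trans (labelled_factor_perm _ _ _ _ _) _.
apply: same_labelled_trans; last exact/same_labelled_sym/labelled_factor_perm.
by rewrite permM permK; exact: same_labelled_refl.
Qed.

Lemma contr_gen_off r (fg : decomp r.+2 X Y) (a : decor D fg) :
  ~ (exists sg, joinable fg sg) -> contr_gen a = 0.
Proof. by rewrite /contr_gen; case: pselect. Qed.

Lemma contr_gen_mlin r (fg : decomp r X Y) : multilinear (@contr_gen r fg).
Proof.
case: r fg => [|[|r]] fg; try by move=> a i c v w; rewrite scaler0 addr0.
case: (pselect (exists sg, joinable fg sg)) => [[sg [hs ht]]|H] a i c v w; last first.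
  by rewrite !contr_gen_off // scaler0 addr0.
rewrite !(contr_genE _ hs ht).
have [j [phi phi_lin E]] : exists j, exists2 phi : D (fib fg.1 i) (fib fg.2 i) ->
    D (fib (perm_dec sg fg.1) j) (fib (perm_dec sg fg.2) j), linear phi &
    forall x, perm_decor sg (dfwith a x) = dfwith (perm_decor sg a) (phi x).
  have [j e] : exists j, i = (sg^-1)%g j by exists (sg i); rewrite permK.
  subst i; exists j, (fun x => fbact (fib_bij (perm_dec_fib sg fg.1 j))
    (fib_bij (perm_dec_fib sg fg.2 j)) x) => [|x]; first exact: fbact_lin.
  apply: functional_extensionality_dep => j'; rewrite /perm_decor.
  case: (eqVneq j j') => [<-|nj]; first by rewrite !dfwith_in.
  by rewrite !dfwith_out // (inj_eq perm_inj).
rewrite !E phi_lin (@join_mlin _ _ _ (perm_decomp sg fg)) scalerDr.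
by rewrite !scalerA mulrC.
Qed.

(** Composing with [sg] turns the orderings admissible for one monomial into
    those admissible for the other. *)
Lemma contr_gen_perm r (sg : 'S_r) (fg : decomp r X Y) (a : decor D fg) :
  contr_gen (perm_decor sg a) = sgn k d sg *: contr_gen a.
Proof.
case: r sg fg a => [|[|r]] sg fg a; try by rewrite scaler0.
have jE sg' : joinable (perm_decomp sg fg) sg' <-> joinable fg (sg * sg')%g.
  by rewrite /joinable /perm_decomp /= !ffunE !permM.
case: (pselect (exists sg', joinable (perm_decomp sg fg) sg')) => [[sg' H]|H]; last first.
  rewrite !contr_gen_off ?scaler0 // => -[sg' H']; apply: H.
  by exists (sg^-1 * sg')%g; apply/jE; rewrite mulKVg.
have H' := (jE _).1 H; case: (H) (H') => hs ht [hs' ht'].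
rewrite (contr_genE _ hs ht) (contr_genE _ hs' ht') scalerA.
rewrite (@join_indep _ _ _ _ _ (perm_decor (sg * sg') a)
  (perm_decor sg' (perm_decor sg a)) _ _ hs' ht' hs ht 1%g).
  rewrite scalerA /sgn odd_perm1; case: (d); rewrite ?mulr1 // odd_permM signr_addb mulrA.
  by rewrite -signr_addb addbb mul1r.
move=> i; apply: same_labelled_trans (labelled_factor_perm _ _ _ _ _) _.
apply: same_labelled_trans (labelled_factor_perm _ _ _ _ _) _.
apply: same_labelled_trans; last exact/same_labelled_sym/labelled_factor_perm.
by rewrite perm1 invMg permM; exact: same_labelled_refl.
Qed.

Definition pow_contr : pow d D X Y -> pow d D (rem s) (rem t) := pow_lift contr_gen.

Lemma pow_contr_lin : linear pow_contr.
Proof. by apply: pow_lift_lin; [exact: contr_gen_mlin|exact: contr_gen_perm]. Qed.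

Lemma pow_contr_cls r (fg : decomp r X Y) (a : decor D fg) :
    pow_contr (cls d a) = contr_gen a.
Proof. by rewrite /pow_contr pow_lift_cls //; [exact: contr_gen_mlin|exact:
  contr_gen_perm]. Qed.

Lemma pow_contr0 r (fg : decomp r X Y) (a : decor D fg) :
  fg.1 s = fg.2 t -> pow_contr (cls d a) = 0.
Proof.
rewrite pow_contr_cls; case: r fg a => [|[|r]] fg a e //.
apply: contr_gen_off => -[sg [/eqP hs /eqP ht]].
by have := lst21 r; rewrite -hs -ht /= !ffunE e eqxx.
Qed.
End Gen.
End Contraction.

Section RepContr.
Context {k : fieldType} (d : sign) (D : dioperad k).

Section One.
Context {X Y : finType} {Z W : Type}.
Variables (labX : X -> Z) (labY : Y -> W).
Hypotheses (labX_inj : injective labX) (labY_inj : injective labY).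
Variables (s : X) (t : Y).

Let labX' (x : rem s) := labX (val x).
Let labY' (y : rem t) := labY (val y).

(** The contraction law in terms of lists: the last two entries are merged and
    the labels keep referring to the same sets. *)
Lemma rep_contr (v : pow d D X Y) (l : seq (labelled D Z W)) (e1 e2 :
    labelled D Z W) (s1 : lp e1) (t2 : lq e2) :
  represents labX labY v (l ++ [:: e1; e2]) -> lu s1 = labX s -> lv t2 = labY t ->
  represents labX' labY' (pow_contr s t v) (rcons l (labelled_mu s1 t2)).
Proof.
case=> r [fg [a [-> sz h]]] es et.
have {}sz : r = (size l).+2 by rewrite -sz size_cat addn2.
move: fg a h; rewrite sz => fg a h {r sz}.
have h1 : same_labelled (labelled_factor labX labY a (lst1 (size l))) e1.
  by have := h (lst1 (size l)); rewrite /= nth_cat ltnn subnn.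
have h2 : same_labelled (labelled_factor labX labY a (lst2 (size l))) e2.
  by have := h (lst2 (size l)); rewrite /= nth_cat ltnNge leqnSn subSnn.
have fs : fg.1 s = lst1 (size l).
  have [th1 [_ [g1 _ _]]] := h1; have := g1 (binv th1 s1).
  by rewrite binvK es => /labX_inj ->; exact: (eqP (valP (binv th1 s1))).
have ft : fg.2 t = lst2 (size l).
  have [_ [th2 [_ g2 _]]] := h2; have := g2 (binv th2 t2).
  by rewrite binvK et => /labY_inj ->; exact: (eqP (valP (binv th2 t2))).
have hs : (perm_decomp 1%g fg).1 s == lst1 (size l) by rewrite ffunE perm1 fs.
have ht : (perm_decomp 1%g fg).2 t == lst2 (size l) by rewrite ffunE perm1 ft.
rewrite pow_contr_cls (contr_genE _ _ hs ht).
have -> : sgn k d (1%g : 'S_(size l).+2) = 1 by rewrite /sgn odd_perm1; case: (d).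
rewrite scale1r; exists (size l).+1, (join_decomp (perm_decomp 1%g fg) s t),
  (join_decor (perm_decor 1%g a) hs ht); split => //; first by rewrite size_rcons.
have p1 i : same_labelled (labelled_factor labX labY (perm_decor 1%g a) i)
  (labelled_factor labX labY a i).
  by have := labelled_factor_perm labX labY 1%g a i; rewrite invg1 perm1.
move=> i; rewrite nth_rcons; case: (eqVneq i ord_max) => [->|ni].
  rewrite /= ltnn eqxx; apply: same_labelled_trans (join_new labX labY _ _ _) _.
  apply: same_labelled_sym; apply: labelled_mu_same.
  - by move=> p q /labX_inj /val_inj.
  - by move=> p q /labY_inj /val_inj.
  - exact: same_labelled_trans (same_labelled_sym h1) (same_labelled_sym (p1 _)).
  - exact: same_labelled_trans (same_labelled_sym h2) (same_labelled_sym (p1 _)).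
  - by rewrite es.
  - by rewrite et.
apply: same_labelled_trans (join_old labX labY _ _ _ ni) _;
  apply: same_labelled_trans (p1 _) _.
by have := h (widen_ord (leqnSn _) i); rewrite /= nth_cat old_lt.
Qed.

Lemma rep_contr_swaps b (L : seq (labelled D Z W)) (v : pow d D X Y) (l :
    seq (labelled D Z W))
    (e1 e2 : labelled D Z W) (s1 : lp e1) (t2 : lq e2) :
  represents labX labY v L -> swaps b L (l ++ [:: e1; e2]) -> lu s1 = labX s ->
    lv t2 = labY t ->
  represents labX' labY' (eps k d b *: pow_contr s t v) (rcons l (labelled_mu s1 t2)).
Proof.
move=> h hsw es et; rewrite -(linZ (pow_contr_lin _ _)).
by apply: rep_contr => //; exact: rep_swaps hsw h.
Qed.

Lemma rep_contr0 (v : pow d D X Y) (L : seq (labelled D Z W)) i (e :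
    labelled D Z W) (s1 : lp e) (t1 : lq e) :
  represents labX labY v L -> (i < size L)%N -> nth labelled0 L i = e ->
  lu s1 = labX s -> lv t1 = labY t -> pow_contr s t v = 0.
Proof.
case=> r [fg [a [-> sz h]]]; rewrite sz => ir ei es et; apply: pow_contr0.
have := h (Ordinal ir); rewrite /= ei => -[th1 [th2 [g1 g2 _]]].
have := g1 (binv th1 s1); rewrite binvK es => /labX_inj ->.
have := g2 (binv th2 t1); rewrite binvK et => /labY_inj ->.
by rewrite (eqP (valP (binv th1 s1))) (eqP (valP (binv th2 t1))).
Qed.
End One.

(** * The order of two contractions *)

(** The relation [ctr_comm] for the powers of a dioperad, at one vector; for
    [d = Plus] the sign is trivial and the contractions commute. *)
Definition anticommute (X Y : finType) (s s' : X) (t t' : Y)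
    (hs : s' != s) (hs' : s != s') (ht : t' != t) (ht' : t != t') (v : pow d D X Y) :=
  forall (th1 : bij (rem (rem_elt hs)) (rem (rem_elt hs')))
         (th2 : bij (rem (rem_elt ht)) (rem (rem_elt ht'))),
    (forall p, val (val (th1 p)) = val (val p)) ->
    (forall q, val (val (th2 q)) = val (val q)) ->
    fbact (f := powFB d D) th1 th2 (pow_contr (rem_elt hs) (rem_elt ht) (pow_contr s t v)) =
    eps k d true *: pow_contr (rem_elt hs') (rem_elt ht') (pow_contr s' t' v).

Section Two.
Context {X Y : finType} (s s' : X) (t t' : Y).
Variables (hs : s' != s) (hs' : s != s') (ht : t' != t) (ht' : t != t').

Lemma anticommute_sym v : anticommute hs' hs ht' ht v -> anticommute hs hs' ht ht' v.
Proof.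
move=> h th1 th2 h1 h2.
have g1 p : val (val (bij_sym th1 p)) = val (val p) by rewrite -h1 /= binvK.
have g2 p : val (val (bij_sym th2 p)) = val (val p) by rewrite -h2 /= binvK.
have E := h (bij_sym th1) (bij_sym th2) g1 g2.
rewrite -[X in eps k d true *: X](@fbact_id _ (powFB d D)).
have -> : bij_id (rem (rem_elt hs')) = bij_comp th1 (bij_sym th1).
  by apply: bij_eq => p; exact/esym/binvK.
have -> : bij_id (rem (rem_elt ht')) = bij_comp th2 (bij_sym th2).
  by apply: bij_eq => p; exact/esym/binvK.
by rewrite fbact_comp E (linZ (fbact_lin (f := powFB d D) _ _)) scalerA eps_sq scale1r.
Qed.

(** Rearranging the factors multiplies a monomial by a sign, so they may be
    placed in any convenient order. *)
Lemma anticommute_scale b v : anticommute hs hs' ht ht' (eps k d b *: v) ->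
  anticommute hs hs' ht ht' v.
Proof.
move=> h th1 th2 h1 h2; have := h th1 th2 h1 h2.
rewrite !(linZ (pow_contr_lin _ _)) (linZ (fbact_lin
  (f := powFB d D) _ _)) scalerA mulrC -scalerA.
by move/(congr1 (fun z => eps k d b *: z)); rewrite !scalerA mulrA eps_sq mul1r scale1r.
Qed.

(** Both iterated contractions are monomials with labels in the original sets,
    so it is enough that they have the same factors up to relabelling and
    opposite signs. *)
Lemma anticommute_rep b1 b2 (v : pow d D X Y) l e e' :
  represents (fun x : rem (rem_elt hs) => val (val x)) (fun y :
    rem (rem_elt ht) => val (val y))
    (eps k d b1 *: pow_contr (rem_elt hs) (rem_elt ht) (pow_contr s t v)) (rcons l e) ->
  represents (fun x : rem (rem_elt hs') => val (val x)) (fun y :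
    rem (rem_elt ht') => val (val y))
    (eps k d b2 *: pow_contr (rem_elt hs') (rem_elt ht') (pow_contr s' t' v))
      (rcons l e') ->
  same_labelled e e' -> b1 (+) b2 -> anticommute hs hs' ht ht' v.
Proof.
move=> r1 r2 ee eb th1 th2 h1 h2.
have r1' := rep_act (labX' := fun x => val (val x)) (labY' := fun y => val (val y))
  (al := th1) (be := th2) h1 h2 r1.
have /(congr1 (fun z => eps k d b1 *: z)) := rep_rcons_eq
  (inj_comp val_inj val_inj) (inj_comp val_inj val_inj) r1' r2 ee.
by rewrite (linZ (pow_act_lin _ _)) !scalerA eps_sq scale1r -eps_addb eb.
Qed.

Section Cases.
Variables (v : pow d D X Y) (l : seq (labelled D X Y)).

(** The pairs link four distinct factors: the two merged factors appear in
    opposite orders, which is the sign. *)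
Lemma anticommute_disjoint (A B C E : labelled D X Y) (sA : lp A) (tB : lq B) (sC :
    lp C) (tE : lq E) :
  represents id id v (l ++ [:: A; B; C; E]) ->
  lu sA = s -> lv tB = t -> lu sC = s' -> lv tE = t' -> anticommute hs hs' ht ht' v.
Proof.
move=> h eA eB eC eE; pose AB := labelled_mu sA tB; pose CE := labelled_mu sC tE.
have w1 : swaps false (l ++ [:: A; B; C; E]) ((l ++ [:: C; E]) ++ [:: A; B]).
  rewrite -catA -[false]/(true (+) true).
  apply: swaps_trans (swaps_back l A [:: B; C; E]) _.
  exact: (swaps_back l B [:: C; E; A]).
have r1 := rep_contr_swaps (@inj_id X) (@inj_id Y) h w1 eA eB.
have w2 : swaps false (rcons (l ++ [:: C; E]) AB) ((l ++ [:: AB]) ++ [:: C; E]).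
  rewrite rcons_cat -catA; apply: swaps_catl.
  exact: (swaps_front AB [:: C; E] [::]).
have r2 := rep_contr_swaps (s := rem_elt hs) (t := rem_elt ht) val_inj val_inj r1 w2 eC eE.
have w3 : swaps false (l ++ [:: A; B; C; E]) ((l ++ [:: A; B]) ++ [:: C; E]).
  by rewrite -catA; exact: swaps_refl.
have r3 := rep_contr_swaps (@inj_id X) (@inj_id Y) h w3 eC eE.
have w4 : swaps false (rcons (l ++ [:: A; B]) CE) ((l ++ [:: CE]) ++ [:: A; B]).
  rewrite rcons_cat -catA; apply: swaps_catl.
  exact: (swaps_front CE [:: A; B] [::]).
have r4 := rep_contr_swaps (s := rem_elt hs')
  (t := rem_elt ht') val_inj val_inj r3 w4 eA eB.
have w5 : swaps true (rcons (l ++ [:: CE]) AB) (rcons (l ++ [:: AB]) CE).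
  by rewrite !rcons_cat; exact: (swaps_adj l CE AB [::]).
have r5 := rep_swaps w5 r4.
rewrite !eps0 !scale1r in r2 r5.
apply: (@anticommute_rep false true v (l ++ [:: AB]) CE CE) => //;
  last exact: same_labelled_refl.
by rewrite eps0 scale1r.
Qed.

Variables (A B C : labelled D X Y).

Lemma swaps_rot3 (T : Type) (r : seq T) x y z :
  swaps false (r ++ [:: x; y; z]) ((r ++ [:: z]) ++ [:: x; y]).
Proof. by rewrite -catA; apply: swaps_catl; exact: (swaps_front z [:: x; y] [::]). Qed.

Lemma swaps_last2 (T : Type) (r : seq T) x y :
  swaps true (rcons (r ++ [:: x]) y) (r ++ [:: y; x]).
Proof. by rewrite rcons_cat; exact: (swaps_adj r x y [::]). Qed.

Lemma swaps_last3 (T : Type) (r : seq T) x y z :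
  swaps true (r ++ [:: x; y; z]) ((r ++ [:: y]) ++ [:: x; z]).
Proof. by rewrite -catA; exact: (swaps_adj r x y [:: z]). Qed.

(** The pairs form a directed chain from [A] through [B] to [C]; the merged
    factors agree by the axiom [dio_assoc]. *)
Lemma anticommute_chain (sA : lp A) (tB : lq B) (sB : lp B) (tC : lq C) :
  represents id id v (l ++ [:: A; B; C]) ->
  lu sA = s -> lv tB = t -> lu sB = s' -> lv tC = t' -> anticommute hs hs' ht ht' v.
Proof.
move=> h eA eB eB' eC; pose AB := labelled_mu sA tB; pose BC := labelled_mu sB tC.
have r1 := rep_contr_swaps (@inj_id X) (@inj_id Y) h (swaps_rot3 _ _ _ _) eA eB.
have r2 := rep_contr_swaps (s := rem_elt hs) (t := rem_elt ht) (e1 := AB) (s1 := inr sB)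
  val_inj val_inj r1 (swaps_last2 _ _ _) eB' eC.
have w3 : swaps false (l ++ [:: A; B; C]) ((l ++ [:: A]) ++ [:: B; C]).
  by rewrite -catA; exact: swaps_refl.
have r3 := rep_contr_swaps (@inj_id X) (@inj_id Y) h w3 eB' eC.
have w4 : swaps false (rcons (l ++ [:: A]) BC) (l ++ [:: A; BC]).
  by rewrite rcons_cat; exact: swaps_refl.
have r4 := rep_contr_swaps (s := rem_elt hs') (t := rem_elt ht') (e2 := BC) (t2 := inl tB)
  val_inj val_inj r3 w4 eA eB.
rewrite !eps0 !scale1r in r2 r4.
apply: (@anticommute_rep true false v l) => //; first exact: r2.
  by rewrite eps0 scale1r; exact: r4.
(* The axiom compares labels in disjoint unions; [f] and [g] send them to the
   labels in [X] and [Y]. *)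
pose f (z : lp A + lp B + lp C) := match z with
  inl (inl p) => lu p | inl (inr p) => lu p | inr p => lu p end.
pose g (z : lq A + lq B + lq C) := match z with
  inl (inl p) => lv p | inl (inr p) => lv p | inr p => lv p end.
apply: (same_relabelled_map (f := f) (g := g) _ _ _ _
  (dio_assoc (lx A) (lx B) (lx C) sA tB sB tC)).
- by case=> [[[p|p] ?]|p].
- by case=> [[p|[p ?]]|[p ?]].
- by case=> [p|[p|p]].
- by case=> [p|[[p|[p ?]] ?]].
Qed.
(** Both pairs end in the factor [B]: this is the axiom [dio_assoc_out], and
    bringing [C] next to [B] gives the sign. *)
Lemma anticommute_target (sA : lp A) (tB tB' : lq B) (sC : lp C) :
  represents id id v (l ++ [:: A; B; C]) ->
  lu sA = s -> lv tB = t -> lu sC = s' -> lv tB' = t' -> anticommute hs hs' ht ht' v.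
Proof.
move=> h eA eB eC eB'.
have n' : tB' != tB by apply: contraNneq ht => e; rewrite -eB' -eB e.
have n : tB != tB' by rewrite eq_sym.
pose AB := labelled_mu sA tB; pose CB := labelled_mu sC tB'.
have r1 := rep_contr_swaps (@inj_id X) (@inj_id Y) h (swaps_rot3 _ _ _ _) eA eB.
have w2 : swaps false (rcons (l ++ [:: C]) AB) (l ++ [:: C; AB]).
  by rewrite rcons_cat; exact: swaps_refl.
have r2 := rep_contr_swaps (s := rem_elt hs) (t := rem_elt ht) (e2 := AB)
  (t2 := inr (rem_elt n')) val_inj val_inj r1 w2 eC eB'.
have w3 : swaps true (l ++ [:: A; B; C]) ((l ++ [:: A]) ++ [:: C; B]).
  by rewrite -catA; apply: swaps_catl; exact: (swaps_adj [:: A] B C [::]).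
have r3 := rep_contr_swaps (@inj_id X) (@inj_id Y) h w3 eC eB'.
have w4 : swaps false (rcons (l ++ [:: A]) CB) (l ++ [:: A; CB]).
  by rewrite rcons_cat; exact: swaps_refl.
have r4 := rep_contr_swaps (s := rem_elt hs') (t := rem_elt ht') (e2 := CB)
  (t2 := inr (rem_elt n)) val_inj val_inj r3 w4 eA eB.
rewrite !eps0 !scale1r in r2 r4; rewrite (linZ (pow_contr_lin _ _)) in r4.
apply: (@anticommute_rep false true v l) => //; first by rewrite eps0 scale1r; exact: r2.
  exact: r4.
pose f (z : lp A + lp B + lp C) := match z with
  inl (inl p) => lu p | inl (inr p) => lu p | inr p => lu p end.
pose g (z : lq A + lq B + lq C) := match z with
  inl (inl p) => lv p | inl (inr p) => lv p | inr p => lv p end.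
apply: (same_relabelled_map (f := f) (g := g) _ _ _ _
  (dio_assoc_out (lx A) (lx B) (lx C) sA sC n n')).
- by case=> [[p ?]|[[p ?]|p]].
- by case=> [p|[[p|[p ?]] ?]].
- by case=> [[p ?]|[[p ?]|p]].
- by case=> [p|[[p|[p ?]] ?]].
Qed.

(** Both pairs start in the factor [A]: this is the axiom [dio_assoc_in]. Here
    [A] comes first in each merging, as it carries the label in [X]. *)
Lemma anticommute_source (sA sA' : lp A) (tB : lq B) (tC : lq C) :
  represents id id v (l ++ [:: A; B; C]) ->
  lu sA = s -> lv tB = t -> lu sA' = s' -> lv tC = t' -> anticommute hs hs' ht ht' v.
Proof.
move=> h eA eB eA' eC.
have n' : sA' != sA by apply: contraNneq hs => e; rewrite -eA' -eA e.
have n : sA != sA' by rewrite eq_sym.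
pose AB := labelled_mu sA tB; pose AC := labelled_mu sA' tC.
have r1 := rep_contr_swaps (@inj_id X) (@inj_id Y) h (swaps_rot3 _ _ _ _) eA eB.
have r2 := rep_contr_swaps (s := rem_elt hs) (t := rem_elt ht) (e1 := AB)
  (s1 := inl (rem_elt n')) val_inj val_inj r1 (swaps_last2 _ _ _) eA' eC.
have r3 := rep_contr_swaps (@inj_id X) (@inj_id Y) h (swaps_last3 _ _ _ _) eA' eC.
have r4 := rep_contr_swaps (s := rem_elt hs') (t := rem_elt ht') (e1 := AC)
  (s1 := inl (rem_elt n)) val_inj val_inj r3 (swaps_last2 _ _ _) eA eB.
rewrite (linZ (pow_contr_lin _ _)) scalerA eps_sq scale1r in r4.
rewrite !eps0 !scale1r in r2.
apply: (@anticommute_rep true false v l) => //; first exact: r2.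
  by rewrite eps0 scale1r; exact: r4.
pose f (z : lp B + lp A + lp C) := match z with
  inl (inl p) => lu p | inl (inr p) => lu p | inr p => lu p end.
pose g (z : lq B + lq A + lq C) := match z with
  inl (inl p) => lv p | inl (inr p) => lv p | inr p => lv p end.
apply: (same_relabelled_map (f := f) (g := g) _ _ _ _
  (dio_assoc_in (lx B) (lx A) (lx C) tB tC n n')).
- by case=> [[[[p ?]|p] ?]|p].
- by case=> [[p|[p ?]]|[p ?]].
- by case=> [[[[p ?]|p] ?]|p].
- by case=> [[p|[p ?]]|[p ?]].
Qed.
End Cases.

Section Zero.
Variables (r : nat) (fg : decomp r X Y) (a : decor D fg).
Local Notation i := (fg.1 s).
Local Notation j := (fg.2 t).
Local Notation i' := (fg.1 s').
Local Notation j' := (fg.2 t').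

(** After the first contraction the labels [s'] and [t'] lie on one factor:
    either they did before, or each lay on one of the two merged factors. *)
Lemma pow_contr2_zero : i != j ->
  i' = j' \/ (i' \in [:: i; j]) && (j' \in [:: i; j]) ->
  pow_contr (rem_elt hs) (rem_elt ht) (pow_contr s t (cls d a)) = 0.
Proof.
move=> nij hyp; have r0 := rep_cls d id id a.
pose F := labelled_factor id id a.
pose pS : lp (F i) := fib_elt (eqxx i); pose pT : lq (F j) := fib_elt (eqxx j).
have key b l : swaps b [seq F i | i <- enum 'I_r] (l ++ [:: F i; F j]) ->
  (exists (e : labelled D X Y) (s1 : lp e) (t1 : lq e) n,
     [/\ (n < size (rcons l (labelled_mu pS pT)))%N,
       nth labelled0 (rcons l (labelled_mu pS pT)) n = e,
         lu s1 = s' & lv t1 = t']) ->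
  pow_contr (rem_elt hs) (rem_elt ht) (pow_contr s t (cls d a)) = 0.
  move=> w [e [s1 [t1 [n [ln en es et]]]]].
  have r1 := rep_contr_swaps (@inj_id X) (@inj_id Y) r0 w (erefl : lu pS = s) (erefl :
    lv pT = t).
  have := rep_contr0 (s := rem_elt hs) (t := rem_elt ht) val_inj val_inj r1 ln en es et.
  rewrite (linZ (pow_contr_lin _ _)) => /(congr1 (fun z => eps k d b *: z)).
  by rewrite scalerA eps_sq scale1r scaler0.
have last_ (l : seq (labelled D X Y)) e : (size l < size (rcons l e))%N /\ nth labelled0
  (rcons l e) (size l) = e.
  by rewrite size_rcons nth_rcons ltnn eqxx.
case: (boolP ((i' \in [:: i; j]) && (j' \in [:: i; j]))) => [/andP[hi hj]|hn].
  have [l [b w]] : exists l b, swaps b [seq F i | i <- enum 'I_r]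
    (l ++ [seq F i | i <- [:: i; j]]).
    by apply: select; rewrite /= inE nij.
  apply: (key b l w).
  have [s1 e1] : exists s1 : lp (labelled_mu pS pT), lu s1 = s'.
    move: hi; rewrite !inE; case: eqP => [e _|_ /= /eqP e].
      have n : fib_elt (introT eqP e : fg.1 s' == i) != pS by rewrite -val_eqE.
      by exists (inl (rem_elt n)).
    by exists (inr (fib_elt (introT eqP e : fg.1 s' == j))).
  have [t1 e2] : exists t1 : lq (labelled_mu pS pT), lv t1 = t'.
    move: hj; rewrite !inE; case: eqP => [e _|_ /= /eqP e].
      by exists (inl (fib_elt (introT eqP e : fg.2 t' == i))).
    have n : fib_elt (introT eqP e : fg.2 t' == j) != pT by rewrite -val_eqE.
    by exists (inr (rem_elt n)).
  by have [z1 z2] := last_ l (labelled_mu pS pT);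
    exists (labelled_mu pS pT), s1, t1, (size l).
case: hyp => [e|]; last by rewrite (negbTE hn).
have ni : i' \notin [:: i; j] by move: hn; rewrite -e andbb.
have [l [b w]] : exists l b, swaps b [seq F i | i <- enum 'I_r]
  (l ++ [seq F i | i <- [:: i'; i; j]]).
  by apply: select; rewrite /= ni inE nij.
apply: (key b (l ++ [:: F i'])); first by rewrite -catA.
exists (F i'), (fib_elt (eqxx i')), (fib_elt (introT eqP (esym e))), (size l); split => //.
- by rewrite size_rcons size_cat addn1 ltnW.
- by rewrite nth_rcons size_cat addn1 ltnSn nth_cat ltnn subnn.
Qed.

End Zero.
End Two.
End RepContr.

Section Main.
Context {k : fieldType} (d : sign).

(** The two pairs are edges of a graph on the factors. If one is a loop or
    they are parallel, both iterated contractions vanish. Otherwise they share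
    one factor, in one of four ways according to the orientations, or none; a
    chain in the reverse direction is a chain after exchanging the pairs. *)
Lemma pow_contr_anticommute (D : dioperad k) (X Y : finType) (s s' : X) (t t' : Y)
    (hs : s' != s) (hs' : s != s') (ht : t' != t) (ht' : t != t') (v : pow d D X Y) :
  anticommute hs hs' ht ht' v.
Proof.
move=> th1 th2 h1 h2; move: v; apply: pow_ext => [||r fg a].
- exact: (lin_comp (fbact_lin (f := powFB d D) th1 th2)
           (lin_comp (pow_contr_lin (rem_elt hs) (rem_elt ht)) (pow_contr_lin s t))).
- move=> c x y; rewrite !pow_contr_lin scalerDr !scalerA; congr (_ *: _ + _).
  exact: mulrC.
move: th1 th2 h1 h2; rewrite -/(anticommute hs hs' ht ht' (cls d a)).
have zero : pow_contr (rem_elt hs) (rem_elt ht) (pow_contr s t (cls d a)) = 0 ->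
    pow_contr (rem_elt hs') (rem_elt ht') (pow_contr s' t' (cls d a)) = 0 ->
    anticommute hs hs' ht ht' (cls d a).
  by move=> z z' th1 th2 _ _; rewrite z z' scaler0 (lin0 (fbact_lin (f := powFB d D) _ _)).
have zz (q : X) (u : Y) (nq : X) (nu : Y) (gs : nq != q) (gt : nu != u) :
    fg.1 q = fg.2 u -> pow_contr (rem_elt gs) (rem_elt gt) (pow_contr q u (cls d a)) = 0.
  by move=> e; rewrite pow_contr0 // (lin0 (pow_contr_lin _ _)).
case: (eqVneq (fg.1 s) (fg.2 t)) => [e|nij].
  apply: zero; first exact: zz.
  case: (eqVneq (fg.1 s') (fg.2 t')) => [e'|nij']; first exact: zz.
  by apply: pow_contr2_zero => //; left.
case: (eqVneq (fg.1 s') (fg.2 t')) => [e'|nij'].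
  apply: zero; last exact: zz.
  by apply: pow_contr2_zero => //; left.
have r0 := rep_cls d id id a.
have sel idx := select (labelled_factor id id a) (idx := idx).
case: (eqVneq (fg.1 s') (fg.1 s)) => [e1|n1].
  case: (eqVneq (fg.2 t') (fg.2 t)) => [e2|n2].
    by apply: zero; apply: pow_contr2_zero => //; right; rewrite !inE e1 e2 !eqxx ?orbT.
  have [|l [b w]] := sel [:: fg.1 s; fg.2 t; fg.2 t'];
    first by rewrite /= !inE negb_or nij -e1 nij' eq_sym n2.
  apply: (anticommute_scale (b := b)).
  apply: (anticommute_source (l := l) (A := labelled_factor id id a (fg.1 s))
    (B := labelled_factor id id a (fg.2 t)) (C := labelled_factor id id a (fg.2 t'))
    (sA := fib_elt (eqxx _)) (sA' := fib_elt (introT eqP e1))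
    (tB := fib_elt (eqxx _)) (tC := fib_elt (eqxx _))) => //.
  exact: rep_swaps w r0.
case: (eqVneq (fg.1 s') (fg.2 t)) => [e1|n2].
  case: (eqVneq (fg.2 t') (fg.1 s)) => [e2|n3].
    by apply: zero; apply: pow_contr2_zero => //; right; rewrite !inE e1 e2 !eqxx ?orbT.
  have [|l [b w]] := sel [:: fg.1 s; fg.2 t; fg.2 t'];
    first by rewrite /= !inE negb_or nij (eq_sym _ (fg.2 t')) n3 -e1 nij'.
  apply: (anticommute_scale (b := b)).
  apply: (anticommute_chain (l := l) (A := labelled_factor id id a (fg.1 s))
    (B := labelled_factor id id a (fg.2 t)) (C := labelled_factor id id a (fg.2 t'))
    (sA := fib_elt (eqxx _)) (sB := fib_elt (introT eqP e1))
    (tB := fib_elt (eqxx _)) (tC := fib_elt (eqxx _))) => //.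
  exact: rep_swaps w r0.
case: (eqVneq (fg.2 t') (fg.1 s)) => [e2|n3].
  have [|l [b w]] := sel [:: fg.1 s'; fg.2 t'; fg.2 t];
    first by rewrite /= !inE negb_or nij' n2 e2 nij.
  apply: anticommute_sym; apply: (anticommute_scale (b := b)).
  apply: (anticommute_chain (l := l) (A := labelled_factor id id a (fg.1 s'))
    (B := labelled_factor id id a (fg.2 t')) (C := labelled_factor id id a (fg.2 t))
    (sA := fib_elt (eqxx _)) (sB := fib_elt (introT eqP (esym e2)))
    (tB := fib_elt (eqxx _)) (tC := fib_elt (eqxx _))) => //.
  exact: rep_swaps w r0.
case: (eqVneq (fg.2 t') (fg.2 t)) => [e2|n4].
  have [|l [b w]] := sel [:: fg.1 s; fg.2 t; fg.1 s'];
    first by rewrite /= !inE negb_or nij !(eq_sym _ (fg.1 s')) n1 n2.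
  apply: (anticommute_scale (b := b)).
  apply: (anticommute_target (l := l) (A := labelled_factor id id a (fg.1 s))
    (B := labelled_factor id id a (fg.2 t)) (C := labelled_factor id id a (fg.1 s'))
    (sA := fib_elt (eqxx _)) (sC := fib_elt (eqxx _))
    (tB := fib_elt (eqxx _)) (tB' := fib_elt (introT eqP e2))) => //.
  exact: rep_swaps w r0.
have [|l [b w]] := sel [:: fg.1 s; fg.2 t; fg.1 s'; fg.2 t'];
  first by rewrite /= !inE !negb_or nij nij' !(eq_sym _ (fg.1 s')) n1 n2 !(eq_sym _
  (fg.2 t')) n3 n4.
apply: (anticommute_scale (b := b)).
apply: (anticommute_disjoint (l := l) (A := labelled_factor id id a (fg.1 s))
  (B := labelled_factor id id a (fg.2 t)) (C := labelled_factor id id a (fg.1 s'))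
    (E := labelled_factor id id a (fg.2 t'))
  (sA := fib_elt (eqxx _)) (sC := fib_elt (eqxx _))
  (tB := fib_elt (eqxx _)) (tE := fib_elt (eqxx _))) => //.
exact: rep_swaps w r0.
Qed.

(** Transporting along bijections does not change the list of labelled
    factors, if the new index sets are labelled by the old ones. *)
Lemma pow_contr_nat (D : dioperad k) (X Y X' Y' : finType) (al : bij X X') (be : bij Y Y')
    (s : X) (t : Y) (v : pow d D X Y) :
  pow_contr (al s) (be t) (pow_act al be v) =
  pow_act (bij_rem al s) (bij_rem be t) (pow_contr s t v).
Proof.
move: v; apply: pow_ext => [||r fg a].
- exact: (lin_comp (pow_contr_lin _ _) (pow_act_lin _ _)).
- exact: (lin_comp (pow_act_lin _ _) (pow_contr_lin _ _)).
case: (eqVneq (fg.1 s) (fg.2 t)) => [e|nij].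
  rewrite pow_act_cls !pow_contr0 ?(lin0 (pow_act_lin _ _)) //.
  by rewrite /= !ffunE !bijK.
have r0 := rep_cls d id id a.
have [|l [b w]] := select (labelled_factor id id a) (idx := [:: fg.1 s; fg.2 t]).
  by rewrite /= inE nij.
pose pS : lp (labelled_factor id id a (fg.1 s)) := fib_elt (eqxx (fg.1 s)).
pose pT : lq (labelled_factor id id a (fg.2 t)) := fib_elt (eqxx (fg.2 t)).
have r1 := rep_contr_swaps (@inj_id X) (@inj_id Y) r0 w (erefl : lu pS = s) (erefl :
  lv pT = t).
have r2 := rep_act (labX' := fun x : rem (al s) => binv al (val x))
  (labY' := fun y : rem (be t) => binv be (val y))
  (al := bij_rem al s) (be := bij_rem be t)
  (fun x => bijK al (val x)) (fun y => bijK be (val y)) r1.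
have r3 := rep_act (labX' := binv al) (labY' := binv be) (bijK al) (bijK be) r0.
have r4 := rep_contr_swaps (s := al s) (t := be t) (s1 := pS) (t2 := pT)
  (can_inj (binvK al)) (can_inj (binvK be)) r3 w (esym (bijK al s)) (esym (bijK be t)).
have ix : injective (fun x : rem (al s) => binv al (val x)).
  by move=> x y /(can_inj (binvK al)) /val_inj.
have iy : injective (fun y : rem (be t) => binv be (val y)).
  by move=> x y /(can_inj (binvK be)) /val_inj.
have /(congr1 (fun z => eps k d b *: z)) := rep_rcons_eq ix iy r4 r2 (same_labelled_refl _).
by rewrite (linZ (pow_act_lin _ _)) !scalerA eps_sq !scale1r.
Qed.

(** A morphism of dioperads commutes with the merging of two labelled factors.
    *)
Lemma pow_contr_map (D E : dioperad k) (h : diop_hom D E) (X Y : finType) (s : X) (t : Y)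
    (v : pow d D X Y) :
  pow_map h (pow_contr s t v) = pow_contr s t (pow_map h v).
Proof.
move: v; apply: pow_ext => [||r fg a].
- exact: (lin_comp (@pow_map_lin _ d D E h _ _) (pow_contr_lin s t)).
- exact: (lin_comp (pow_contr_lin s t) (@pow_map_lin _ d D E h X Y)).
case: (eqVneq (fg.1 s) (fg.2 t)) => [e|nij].
  by rewrite pow_map_cls !pow_contr0 ?(lin0 (@pow_map_lin _ d D E h _ _)).
have r0 := rep_cls d id id a.
have [|l [b w]] := select (labelled_factor id id a) (idx := [:: fg.1 s; fg.2 t]).
  by rewrite /= inE nij.
pose pS : lp (labelled_factor id id a (fg.1 s)) := fib_elt (eqxx (fg.1 s)).
pose pT : lq (labelled_factor id id a (fg.2 t)) := fib_elt (eqxx (fg.2 t)).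
have r1 := rep_contr_swaps (@inj_id X) (@inj_id Y) r0 w (erefl : lu pS = s) (erefl :
  lv pT = t).
have r2 := rep_map h r1; rewrite map_rcons in r2.
have r3 := rep_map h r0.
have w' := swaps_map (labelled_map h (Z := X) (W := Y)) w; rewrite map_cat in w'.
have r4 := rep_contr_swaps (@inj_id X) (@inj_id Y) (e1 := labelled_map h
  (labelled_factor id id a (fg.1 s)))
  (e2 := labelled_map h (labelled_factor id id a (fg.2 t))) (s1 := pS) (t2 := pT) (s := s)
    (t := t) r3 w'
  erefl erefl.
have e : same_labelled (labelled_map h (labelled_mu pS pT)) (labelled_mu
  (e1 := labelled_map h (labelled_factor id id a (fg.1 s)))
  (e2 := labelled_map h (labelled_factor id id a (fg.2 t))) pS pT).
  by exists (bij_id _), (bij_id _); split => //; rewrite fbact_id /= dhom_mu.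
have /(congr1 (fun z => eps k d b *: z)) := rep_rcons_eq val_inj val_inj r2 r4 e.
by rewrite (linZ (@pow_map_lin _ d D E h _ _)) !scalerA eps_sq !scale1r.
Qed.

Definition pow_contractions (D : dioperad k) : contractions d (powFB d D) :=
  @Build_contractions k d (powFB d D) (fun X Y s t => pow_contr s t)
    (fun X Y s t => pow_contr_lin s t)
    (fun X Y X' Y' al be s t v => pow_contr_nat al be s t v)
    (fun X Y s s' t t' hs hs' ht ht' th1 th2 v =>
       @pow_contr_anticommute D X Y s s' t t' hs hs' ht ht' v th1 th2).

Definition pow_structure (D : dioperad k) : dwb_structure d (powFB d D) :=
  contr_structure (pow_contractions D).

Lemma pow_contraction_law (D : dioperad k) : contraction_law (pow_structure D).
Proof.
split=> [r X Y fg a s t e|r X Y fg a s t sg hs ht].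
  by rewrite contr_structureE /= pow_contr0.
by rewrite contr_structureE /= pow_contr_cls (contr_genE _ _ hs ht).
Qed.

Definition pow_linmod_hom (D E : dioperad k) (h : diop_hom D E) :
    linmod_hom (dwb_linmod (pow_structure D)) (dwb_linmod (pow_structure E)) :=
  @Build_linmod_hom k (dwb k d) (dwb_linmod (pow_structure D)) (dwb_linmod
    (pow_structure E))
    (fun x => pow_FBhom d h x.1 x.2) (fun x => fbh_lin (pow_FBhom d h) (X := x.1)
      (Y := x.2))
    (fun x y f v => uact_nat (c := pow_contractions D) (c' := pow_contractions E)
       (h := pow_FBhom d h) (pow_contr_map h) f v).

Lemma pow_linmod_hom_id (D : dioperad k) :
  pow_linmod_hom (diop_id D) = linmod_id (dwb_linmod (pow_structure D)).
Proof.
apply: linmod_hom_eq => x v /=; move: v; apply: pow_ext.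
- exact: pow_map_lin.
- exact: lin_id.
by move=> r fg a; rewrite pow_map_cls.
Qed.

Lemma pow_linmod_hom_comp (D E F : dioperad k) (g : diop_hom E F) (f : diop_hom D E) :
  pow_linmod_hom (diop_comp g f) = linmod_comp (pow_linmod_hom g) (pow_linmod_hom f).
Proof.
apply: linmod_hom_eq => x v /=; move: v; apply: pow_ext.
- exact: pow_map_lin.
- exact: (lin_comp (@pow_map_lin _ d E F g _ _) (@pow_map_lin _ d D E f _ _)).
by move=> r fg a; rewrite !pow_map_cls.
Qed.

Definition pow_functor :
    functor_on (C := Diop k) (D := Mod (dwb k d)) (fun D => dwb_linmod (pow_structure D)) :=
  @Build_functor_on (Diop k) (Mod (dwb k d)) (fun D => dwb_linmod (pow_structure D))
    pow_linmod_hom pow_linmod_hom_id pow_linmod_hom_comp.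
End Main.

Theorem theorem8p3 (k : fieldType) (k_char0 : [pchar k] =i pred0) :
  (exists m : forall D : dioperad k, dwb_structure Plus (Sconv D),
     (forall D : dioperad k, contraction_law (d := Plus) (m D)) /\
     (exists Phi : functor_on (C := Diop k) (D := Mod (dwb k Plus))
                     (fun D => dwb_linmod (m D)),
        forall (D E : Diop k) (h : chom D E) (X Y : finType) (x : Sconv D X Y),
          fmap Phi h (X, Y) x = pow_FBhom Plus h X Y x))
  /\
  (exists m : forall D : dioperad k, dwb_structure Minus (Lconv D),
     (forall D : dioperad k, contraction_law (d := Minus) (m D)) /\
     (exists Phi : functor_on (C := Diop k) (D := Mod (dwb k Minus))
                     (fun D => dwb_linmod (m D)),
        forall (D E : Diop k) (h : chom D E) (X Y : finType) (x : Lconv D X Y),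
          fmap Phi h (X, Y) x = pow_FBhom Minus h X Y x)).
Proof.
split; exists (pow_structure (k := k) _); split; try exact: pow_contraction_law;
  by exists (pow_functor _).
Qed.
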